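(* For any decreasing function $s:(0,\infty)\to(0,\infty)$ such that $\lim_{t\to0}s(t)=\infty$, there exist a positive superharmonic function $\varphi$ on $U_+$ and $y_0>0$ such that $$\varphi(x+iy)\le s(y)\quad\text{for all } x\in\mathbb{R},\ 0<y<y_0,$$ but there does not exist any harmonic function $h$ on $U_+$ such that $h(z)\ge\varphi(z)$ for all $z\in U_+$.
   Context: $U_+=\{z\in\mathbb{C}:\operatorname{Im}z>0\}$ is the upper half-plane. *)

(* Defs.v *)
From HB Require Import structures.
From mathcomp Require Import all_boot all_order all_algebra.
From mathcomp Require Import all_classical all_reals all_analysis.

Set Implicit Arguments.
Unset Strict Implicit.
Unset Printing Implicit Defensive.

Import Order.TTheory GRing.Theory Num.Theory.
Import numFieldNormedType.Exports.

Local Open Scope classical_set_scope.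
Local Open Scope ring_scope.

(* The complex plane is R * R, the point x + iy being (x, y), so that real
   partial derivatives are the library's directional derivatives.  The product
   topology is the Euclidean one; the library norm on R * R is the sup norm,
   hence the explicit Euclidean discs below. *)

Definition upper_half_plane (R : realType) : set (R * R) :=
  [set z | 0 < z.2].

Definition closed_disc (R : realType) (a : R * R) (r : R) : set (R * R) :=
  [set z | (z.1 - a.1) ^+ 2 + (z.2 - a.2) ^+ 2 <= r ^+ 2].

Definition circle_mean (R : realType) (f : R * R -> \bar R) (a : R * R) (r : R)
    : \bar R :=
  (((2 * pi)^-1)%:E *
   \int[lebesgue_measure]_(t in `[0%R, (2 * pi)%R])
      f (a.1 + r * cos t, a.2 + r * sin t)%R)%E.

(* U is meant to be a connected open set, so that being not identically +oo
   on U is the right nondegeneracy condition.  The last three conditions are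
   not -oo, lower semicontinuity (the library's [lower_semicontinuous],
   localized to U) and the super-mean-value inequality over every closed disc
   contained in U. *)
Definition superharmonic (R : realType) (U : set (R * R))
    (f : R * R -> \bar R) : Prop :=
  [/\ exists2 z, U z & f z != +oo%E,
      forall z, U z -> f z != -oo%E,
      forall z, U z -> forall a : R, (a%:E < f z)%E ->
        \forall w \near z, (a%:E < f w)%E
    & forall a r, 0 < r -> closed_disc a r `<=` U ->
        (circle_mean f a r <= f a)%E].

Definition e_x (R : realType) : R * R := (1, 0).
Definition e_y (R : realType) : R * R := (0, 1).

(* On an open U, existence and continuity of all second-order partial
   derivatives already makes f of class C^2. *)
Definition class_C2 (R : realType) (U : set (R * R)) (f : R * R -> R) : Prop :=
  forall u v : R * R, u \in [:: e_x R; e_y R] -> v \in [:: e_x R; e_y R] ->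
  forall z, U z ->
    [/\ derivable f z u, derivable ('D_u f) z v
      & {for z, continuous ('D_v ('D_u f))}].

Definition laplacian (R : realType) (f : R * R -> R) (z : R * R) : R :=
  'D_(e_x R) ('D_(e_x R) f) z + 'D_(e_y R) ('D_(e_y R) f) z.

Definition harmonic_on (R : realType) (U : set (R * R)) (f : R * R -> R)
    : Prop :=
  class_C2 U f /\ forall z, U z -> laplacian f z = 0.

(* Main.v *)
Require Import Defs.
From mathcomp Require Import all_boot all_order all_algebra.
From mathcomp Require Import all_classical all_reals all_analysis measurable_realfun.
From mathcomp Require Import ring lra.

Import Order.TTheory GRing.Theory Num.Theory.
Import numFieldNormedType.Exports.

Set Implicit Arguments.
Unset Strict Implicit.
Unset Printing Implicit Defensive.

Local Open Scope classical_set_scope.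
Local Open Scope ring_scope.

(* phi is a sum over n of functions psi_n, each a finite sum of smoothed
   logarithmic potentials
     eps (ln (|z - conj p|^2 + c) - ln (|z - p|^2 + c)), eps > 0, c > 0,
   which are superharmonic, with poles p spaced a_n / 4 apart on the segment
   |x| <= 2 at height a_n -> 0.  Letting eps and then c be tiny makes psi_n at
   most 2^-n outside the band |y - a_n| < a_n / 4 and at most M_n + 2^-n inside
   it, while psi_n >= M_n / 2 at the poles; M_n = s(2 a_n) / 2 -> oo keeps phi
   below s.  A harmonic h >= phi has h >= M_n / 2 at the poles, hence
   h >= c M_n on the whole segment by Harnack's inequality, hence
   h(0, 1) >= c' M_n by comparison with an explicit harmonic function, which is
   absurd.

   All facts about harmonic functions are derived from the weak minimum
   principle for functions having a second-order Peano expansion.  Applied to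
   the average of f over the N rotations by multiples of 2 pi / N, it gives the
   mean value inequality up to a Riemann sum error; applied to the difference
   of f and a Riemann sum of its Poisson integral, with poles slightly outside
   the disc, it gives Harnack's inequality. *)

(** * Second-order Peano expansions and their calculus *)

Definition taylor2 {R : realType} (f : R * R -> R) (z : R * R)
    (a b A B C : R) : Prop :=
  forall e, 0 < e -> exists2 d, 0 < d & forall u v, `|u| < d -> `|v| < d ->
    `|f (z.1 + u, z.2 + v)
      - (f z + a * u + b * v + A * u ^+ 2 + B * (u * v) + C * v ^+ 2)|
    <= e * (u ^+ 2 + v ^+ 2).

(** For a C^2 function [A] and [C] are half the pure second derivatives, so [L] is the Laplacian.
    Working with an expansion at the single point [z] makes sums, products and compositions plain
    algebra on coefficients. *)
Definition has_lap {R : realType} (f : R * R -> R) (z : R * R) (L : R) : Prop :=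
  exists a b A B C, taylor2 f z a b A B C /\ L = (A + C) *+ 2.

Definition taylor1 {R : realType} (F : R -> R) (t p q : R) : Prop :=
  forall e, 0 < e -> exists2 d, 0 < d & forall s, `|s| < d ->
    `|F (t + s) - (F t + p * s + q * s ^+ 2)| <= e * s ^+ 2.

Section Taylor.
Context {R : realType}.
Implicit Types (f g : R * R -> R) (z : R * R).

Lemma taylor2_exact f z a b A B C :
  (forall u v, f (z.1 + u, z.2 + v) =
     f z + a * u + b * v + A * u ^+ 2 + B * (u * v) + C * v ^+ 2) ->
  taylor2 f z a b A B C.
Proof.
move=> H e e0; exists 1 => // u v _ _.
by rewrite H subrr normr0 mulr_ge0 ?addr_ge0 ?sqr_ge0 // ltW.
Qed.

Lemma taylor2_eq f z a b A B C a' b' A' B' C' :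
  taylor2 f z a b A B C -> a = a' -> b = b' -> A = A' -> B = B' -> C = C' ->
  taylor2 f z a' b' A' B' C'.
Proof. by move=> H <- <- <- <- <-. Qed.

Lemma eq_taylor2 f g z a b A B C : f =1 g ->
  taylor2 f z a b A B C -> taylor2 g z a b A B C.
Proof. by move=> /funext ->. Qed.

Lemma taylor2_lin f g z (p q : R) a b A B C a' b' A' B' C' :
  taylor2 f z a b A B C -> taylor2 g z a' b' A' B' C' ->
  taylor2 (fun w => p * f w + q * g w) z (p * a + q * a') (p * b + q * b')
    (p * A + q * A') (p * B + q * B') (p * C + q * C').
Proof.
move=> Hf Hg e e0.
have p0 : 0 <= `|p| by []. have q0 : 0 <= `|q| by [].
have [d d0 Hd] := Hf (e / (2 * (`|p| + 1))) ltac:(by apply: divr_gt0 => //; lra).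
have [d' d0' Hd'] := Hg (e / (2 * (`|q| + 1))) ltac:(by apply: divr_gt0 => //; lra).
exists (Num.min d d') => [|u v]; first by rewrite lt_min d0.
rewrite !lt_min => /andP[ud ud'] /andP[vd vd'].
move: {Hd}(Hd u v ud vd) {Hd'}(Hd' u v ud' vd').
set E := (X in `|X| <= _ -> _); set E' := (X in _ -> `|X| <= _ -> _).
set r := u ^+ 2 + v ^+ 2 => HE HE'.
have r0 : 0 <= r by rewrite addr_ge0 ?sqr_ge0.
set G := (X in `|X|); have -> : G = p * E + q * E' by rewrite /G /E /E'; ring.
apply: le_trans (ler_normD _ _) _; rewrite !normrM.
have K (x m : R) : 0 <= x -> m <= e / (2 * (x + 1)) * r -> 
    x * m <= e / 2 * r.
  move=> x0 Hm.
  have := ler_wpM2l x0 Hm; move/le_trans; apply.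
  rewrite -subr_ge0.
  have -> : e / 2 * r - x * (e / (2 * (x + 1)) * r) = e * r / (2 * (x + 1)).
    by field; lra.
  by apply: divr_ge0; [apply: mulr_ge0 => //; lra|lra].
have := K _ _ p0 HE; have := K _ _ q0 HE'; lra.
Qed.

(** Prepares the chain rule: the increment of [f] is small enough for the expansion of the outer
    function, and close enough to its linear part to be replaced by it inside a square. *)
Lemma taylor2_small f z a b A B C : taylor2 f z a b A B C ->
  exists K, 0 < K /\ exists2 d, 0 < d & forall u v, `|u| < d -> `|v| < d ->
    `|f (z.1 + u, z.2 + v) - f z - (a * u + b * v)| <= K * (`|u| + `|v|) ^+ 2 /\
    `|f (z.1 + u, z.2 + v) - f z| <= K * (`|u| + `|v|).
Proof.
move=> H; have [d d0 Hd] := H 1 ltr01.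
pose K0 := `|A| + `|B| + `|C| + 1.
have K00 : 0 < K0 by rewrite /K0 ltr_wpDl ?addr_ge0.
exists (K0 + `|a| + `|b|); split; first by rewrite -addrA ltr_wpDr ?addr_ge0.
exists (Num.min d (1/2)) => [|u v].
  by rewrite lt_min d0 /=; clear; lra.
rewrite !lt_min => /andP[ud u1] /andP[vd v1].
have := Hd u v ud vd; move: (f (_, _)) (f z) => D F; rewrite mul1r.
have L1 : `|a * u + b * v| <= (`|a| + `|b|) * (`|u| + `|v|).
  apply: le_trans (ler_normD _ _) _; rewrite !normrM.
  have := mulr_ge0 (normr_ge0 a) (normr_ge0 v).
  by have := mulr_ge0 (normr_ge0 b) (normr_ge0 u); clear; lra.
have L2 : `|A * u ^+ 2 + B * (u * v) + C * v ^+ 2| <=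
    (`|A| + `|B| + `|C|) * (`|u| + `|v|) ^+ 2.
  apply: le_trans (ler_normD _ _) _.
  apply: le_trans (lerD (ler_normD _ _) (lexx _)) _; rewrite !normrM.
  have := normr_ge0 u; have := normr_ge0 v; move: `|u| `|v| => x y y0 x0.
  have xy0 := mulr_ge0 x0 y0.
  rewrite !mulrDl; apply: lerD; [apply: lerD|]; apply: ler_wpM2l => //.
  - by move: (sqr_ge0 y) xy0; clear; lra.
  - by move: (sqr_ge0 x) (sqr_ge0 y) xy0; clear; lra.
  - by move: (sqr_ge0 x) xy0; clear; lra.
have w2 : u ^+ 2 + v ^+ 2 <= (`|u| + `|v|) ^+ 2.
  rewrite -(real_normK (num_real u)) -(real_normK (num_real v)).
  by have := mulr_ge0 (normr_ge0 u) (normr_ge0 v); clear; lra.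
have w1 : `|u| + `|v| <= 1 by move: u1 v1; clear; lra.
have w0 : 0 <= `|u| + `|v| by rewrite addr_ge0.
move: (`|u| + `|v|) w0 w1 w2 L1 L2 => w w0 w1 w2 L1 L2 H3.
have H4 : `|D - F - (a * u + b * v)| <= K0 * w ^+ 2.
  have -> : D - F - (a * u + b * v) = (D - (F + a * u + b * v + A * u ^+ 2 +
      B * (u * v) + C * v ^+ 2)) + (A * u ^+ 2 + B * (u * v) + C * v ^+ 2) by ring.
  apply: le_trans (ler_normD _ _) _; apply: le_trans (lerD (le_trans H3 w2) L2) _.
  by rewrite /K0 [leRHS]mulrDl mul1r addrC.
split.
  apply: le_trans H4 _; apply: ler_wpM2r; first exact: sqr_ge0.
  by rewrite -addrA lerDl addr_ge0.
have -> : D - F = (D - F - (a * u + b * v)) + (a * u + b * v) by ring.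
apply: le_trans (ler_normD _ _) _; apply: le_trans (lerD H4 L1) _.
rewrite -[K0 + _ + _]addrA [leRHS]mulrDl; apply: lerD => //.
by apply: ler_wpM2l; [exact: ltW|rewrite expr2 ler_piMl].
Qed.

(* The error of the composition splits into the error of F, the error of f
   multiplied by F', and the replacement of the increment by its linear part. *)
Let comp_error (e p q K La r w s l E G : R) :
  0 < e -> 0 < K -> 0 <= La -> 0 <= w -> 0 <= r -> w ^+ 2 <= 2 * r ->
  w * (6 * ((`|q| + 1) * K * (K + La))) <= e ->
  `|s - l| <= K * w ^+ 2 -> `|s| <= K * w -> `|l| <= La * w ->
  `|E| <= e / (3 * (`|p| + 1)) * r -> `|G| <= e / (6 * K ^+ 2) * s ^+ 2 ->
  `|G + p * E + q * ((s - l) * (s + l))| <= e * r.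
Proof.
move=> e0 K0 La0 w0 r0 wr we sl sw lw Er Gs.
have b1 : `|G| <= e / 3 * r.
  apply: le_trans Gs _; rewrite mulrAC ler_pdivrMr ?mulr_gt0 ?exprn_gt0 //.
  have s2 : s ^+ 2 <= K ^+ 2 * (2 * r).
    apply: (@le_trans _ _ ((K * w) ^+ 2)).
      by rewrite -(real_normK (num_real s)) lerXn2r ?nnegrE ?mulr_ge0 // ltW.
    by rewrite exprMn; apply: ler_wpM2l => //; exact: sqr_ge0.
  apply: le_trans (ler_wpM2l (ltW e0) s2) _.
  by rewrite le_eqVlt; apply/orP; left; apply/eqP; field.
have b2 : `|p * E| <= e / 3 * r.
  rewrite normrM; apply: le_trans (ler_wpM2l (normr_ge0 p) Er) _.
  rewrite mulrA; apply: ler_wpM2r => //.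
  have P0 : 0 < 3 * (`|p| + 1) by rewrite mulr_gt0 // ltr_wpDl.
  rewrite mulrA ler_pdivrMr //; have -> : e / 3 * (3 * (`|p| + 1)) = e * (`|p| + 1).
    by field.
  by rewrite mulrC ler_pM2l // lerDl.
have b3 : `|q * ((s - l) * (s + l))| <= e / 3 * r.
  have Q0 : 0 <= (`|q| + 1) * K * (K + La).
    by rewrite !mulr_ge0 ?addr_ge0 // ltW.
  apply: (@le_trans _ _ (w * ((`|q| + 1) * K * (K + La)) * w ^+ 2)).
    rewrite !normrM.
    have sl' : `|s + l| <= (K + La) * w.
      by apply: le_trans (ler_normD _ _) _; rewrite mulrDl lerD.
    have q1 : `|q| <= `|q| + 1 by rewrite lerDl.
    apply: le_trans (ler_pM (normr_ge0 q) _ q1 (ler_pM (normr_ge0 _) (normr_ge0 _) sl sl')) _.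
      by rewrite mulr_ge0.
    by rewrite le_eqVlt; apply/orP; left; apply/eqP; ring.
  have -> : e / 3 * r = e / 6 * (2 * r) by field.
  apply: ler_pM => //; first exact: mulr_ge0.
    exact: sqr_ge0.
  rewrite ler_pdivlMr // [leLHS](_ : _ = w * (6 * ((`|q| + 1) * K * (K + La)))) //.
  by ring.
apply: le_trans (ler_normD _ _) _; apply: le_trans (lerD (ler_normD _ _) (lexx _)) _.
by move: b1 b2 b3; clear; lra.
Qed.

(** Insert the increment [s] of [f] into the expansion of [F]: the term [p s] gives [p] times the
    expansion of [f], and in [q s^2] the increment may be replaced by [a u + b v]. *)
Lemma taylor2_comp (F : R -> R) p q f z a b A B C :
  taylor2 f z a b A B C -> taylor1 F (f z) p q ->
  taylor2 (F \o f) z (p * a) (p * b) (p * A + q * a ^+ 2)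
    (p * B + q * (a * b) *+ 2) (p * C + q * b ^+ 2).
Proof.
move=> Hf HF e e0.
have [K [K0 [d1 d10 H1]]] := taylor2_small Hf.
have e10 : 0 < e / (6 * K ^+ 2) by rewrite divr_gt0 // mulr_gt0 // exprn_gt0.
have [d2 d20 H2] := HF _ e10.
have e30 : 0 < e / (3 * (`|p| + 1)) by rewrite divr_gt0 // mulr_gt0 // ltr_wpDl.
have [d3 d30 H3] := Hf _ e30.
have La0 : 0 <= `|a| + `|b| by rewrite addr_ge0.
have k0 : 0 < 6 * ((`|q| + 1) * K * (K + (`|a| + `|b|))).
  apply: mulr_gt0 => //; apply: mulr_gt0; last exact: ltr_pwDl.
  by apply: mulr_gt0 => //; exact: ltr_wpDl.
have w00 : 0 < Num.min (d2 / K) (e / (6 * ((`|q| + 1) * K * (K + (`|a| + `|b|))))).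
  by rewrite lt_min !divr_gt0.
exists (Num.min (Num.min d1 d3)
  (Num.min (d2 / K) (e / (6 * ((`|q| + 1) * K * (K + (`|a| + `|b|))))) / 2)) => [|u v].
  by rewrite !lt_min d10 d30 divr_gt0.
rewrite 2!lt_min => /andP[/andP[ud1 ud3] uw].
rewrite 2!lt_min => /andP[/andP[vd1 vd3] vw].
have [h1 h2] := H1 u v ud1 vd1; have h3 := H3 u v ud3 vd3.
have : `|u| + `|v| < Num.min (d2 / K) (e / (6 * ((`|q| + 1) * K * (K + (`|a| + `|b|))))).
  by rewrite [ltRHS]splitr ltrD.
rewrite lt_min !ltr_pdivlMr // => /andP[wK we].
rewrite mulrC in wK; have h4 := H2 _ (le_lt_trans h2 wK).
rewrite subrKC in h4.
rewrite /= [X in `|X|](_ : _ = (F (f (z.1 + u, z.2 + v)) - (F (f z) +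
  p * (f (z.1 + u, z.2 + v) - f z) + q * (f (z.1 + u, z.2 + v) - f z) ^+ 2)) +
  p * (f (z.1 + u, z.2 + v) -
    (f z + a * u + b * v + A * u ^+ 2 + B * (u * v) + C * v ^+ 2)) +
  q * ((f (z.1 + u, z.2 + v) - f z - (a * u + b * v)) *
    (f (z.1 + u, z.2 + v) - f z + (a * u + b * v)))); last by ring.
apply: (comp_error e0 K0 La0 (addr_ge0 (normr_ge0 u) (normr_ge0 v)) _ _ (ltW we)
  h1 h2 _ h3 h4); first by rewrite addr_ge0 ?sqr_ge0.
- rewrite -(real_normK (num_real u)) -(real_normK (num_real v)).
  by have := sqr_ge0 (`|u| - `|v|); clear; lra.
apply: le_trans (ler_normD _ _) _; rewrite !normrM.
have := mulr_ge0 (normr_ge0 a) (normr_ge0 v).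
by have := mulr_ge0 (normr_ge0 b) (normr_ge0 u); clear; lra.
Qed.

Lemma taylor1_sqr (t : R) : taylor1 (fun x => x ^+ 2) t (t *+ 2) 1.
Proof.
move=> e e0; exists 1 => // s _.
have -> : (t + s) ^+ 2 - (t ^+ 2 + t *+ 2 * s + 1 * s ^+ 2) = 0 by ring.
by rewrite normr0 mulr_ge0 ?sqr_ge0 // ltW.
Qed.

(** Polarization: [f g = ((f + g)^2 - (f - g)^2) / 4] reduces the product to linearity and
    composition with the square. *)
Lemma taylor2M f g z a b A B C a' b' A' B' C' :
  taylor2 f z a b A B C -> taylor2 g z a' b' A' B' C' ->
  taylor2 (fun w => f w * g w) z (a * g z + f z * a') (b * g z + f z * b')
    (A * g z + f z * A' + a * a') (B * g z + f z * B' + a * b' + b * a')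
    (C * g z + f z * C' + b * b').
Proof.
move=> Hf Hg.
have P := taylor2_comp (taylor2_lin 1 1 Hf Hg)
  (taylor1_sqr _).
have M := taylor2_comp (taylor2_lin 1 (-1) Hf Hg)
  (taylor1_sqr _).
have := taylor2_lin 4^-1 (- 4^-1) P M.
move/(@eq_taylor2 _ (fun w => f w * g w)) => H.
apply: (taylor2_eq (H _)); first by move=> w /=; field.
all: by field.
Qed.

End Taylor.

(** * The pointwise Laplacian and the weak minimum principle *)

Section HasLap.
Context {R : realType}.
Implicit Types (f g : R * R -> R) (z : R * R).

Lemma has_lap_lin f g z (p q L M : R) : has_lap f z L -> has_lap g z M ->
  has_lap (fun w => p * f w + q * g w) z (p * L + q * M).
Proof.
move=> [a [b [A [B [C [Hf ->]]]]]] [a' [b' [A' [B' [C' [Hg ->]]]]]].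
do 5 eexists; split; first exact: (taylor2_lin p q Hf Hg).
by ring.
Qed.

Lemma has_lap_cst (k : R) z : has_lap (fun=> k) z 0.
Proof.
exists 0, 0, 0, 0, 0; split; last by rewrite addr0 mul0rn.
by apply: taylor2_exact => u v; ring.
Qed.

Lemma has_lap_norm2 z : has_lap (fun w => w.1 ^+ 2 + w.2 ^+ 2) z 4.
Proof.
exists (z.1 *+ 2), (z.2 *+ 2), 1, 0, 1; split; last by ring.
by apply: taylor2_exact => u v /=; ring.
Qed.

(** The inner map is [w -> p + (al + i be) w]; being conformal, it multiplies the Laplacian by
    [|al + i be|^2]. Rotations and dilations are both of this form. *)
Lemma has_lap_simil f (p : R * R) (al be L : R) z :
  has_lap f (p.1 + al * z.1 - be * z.2, p.2 + be * z.1 + al * z.2) L ->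
  has_lap (fun w => f (p.1 + al * w.1 - be * w.2, p.2 + be * w.1 + al * w.2)) z
    ((al ^+ 2 + be ^+ 2) * L).
Proof.
move=> [a [b [A [B [C [Hf ->]]]]]].
exists (a * al + b * be), (b * al - a * be),
  (A * al ^+ 2 + B * (al * be) + C * be ^+ 2),
  (- A * (al * be) *+ 2 + B * (al ^+ 2 - be ^+ 2) + C * (al * be) *+ 2),
  (A * be ^+ 2 - B * (al * be) + C * al ^+ 2); split; last by ring.
move=> e e0; pose K := `|al| + `|be| + 1.
have K0 : 0 < K by rewrite ltr_wpDl ?addr_ge0.
have Ks : al ^+ 2 + be ^+ 2 <= K ^+ 2.
  rewrite -(real_normK (num_real al)) -(real_normK (num_real be)) /K.
  by move: (normr_ge0 al) (normr_ge0 be); clear; nra.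
have [d d0 Hd] := Hf (e / K ^+ 2) (divr_gt0 e0 (exprn_gt0 2 K0)).
exists (d / K) => [|u v]; first exact: divr_gt0.
rewrite !ltr_pdivlMr // => ud vd.
have bnd (x y s t : R) : `|x| + `|y| < K -> `|s| * K < d -> `|t| * K < d ->
    `|x * s + y * t| < d.
  move=> xy sd td; apply: le_lt_trans (ler_normD _ _) _; rewrite !normrM.
  have := ler_wpM2l (normr_ge0 x) (ltW sd).
  have := ler_wpM2l (normr_ge0 y) (ltW td).
  rewrite -(ltr_pM2r K0); set X := `|x| in xy *; set Y := `|y| in xy *.
  have : (X + Y) * d < K * d by rewrite ltr_pM2r.
  clear; lra.
have h1 : `|al * u + - be * v| < d.
  by apply: bnd; rewrite // normrN /K; lra.
have h2 : `|be * u + al * v| < d.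
  by apply: bnd; rewrite // /K; lra.
have := Hd _ _ h1 h2; rewrite /=.
set D := f (_ + _, _); set D' := (X in _ -> `|X - _| <= _).
have -> : D' = D by rewrite /D' /D; congr (f (_, _)); ring.
move=> H; rewrite [X in `|X|](_ : _ = D - (f
     (p.1 + al * z.1 - be * z.2,
      p.2 + be * z.1 + al * z.2) +
   a * (al * u + - be * v) +
   b * (be * u + al * v) +
   A * (al * u + - be * v) ^+ 2 +
   B *
   ((al * u + - be * v) *
    (be * u + al * v)) +
   C * (be * u + al * v) ^+ 2)); last by ring.
apply: le_trans H _.
have -> : (al * u + - be * v) ^+ 2 + (be * u + al * v) ^+ 2 =
  (al ^+ 2 + be ^+ 2) * (u ^+ 2 + v ^+ 2) by ring.
rewrite mulrA; apply: ler_wpM2r; first by rewrite addr_ge0 ?sqr_ge0.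
by rewrite mulrAC ler_pdivrMr ?exprn_gt0 // ler_wpM2l // ltW.
Qed.

Lemma has_lap_continuous f z L : has_lap f z L -> {for z, continuous f}.
Proof.
move=> [a [b [A [B [C [Hf _]]]]]].
have [K [K0 [d d0 Hd]]] := taylor2_small Hf.
apply/cvgrPdist_le => /= e e0.
have eK : 0 < e / (2 * K) by rewrite divr_gt0 ?mulr_gt0.
have m0 : 0 < Num.min d (e / (2 * K)) by rewrite lt_min d0.
apply: filterS (nbhsx_ballx z _ m0) => -[x y] [/= ].
rewrite /ball /= !lt_min => /andP[x1 x2] /andP[y1 y2].
have [|| _] := Hd (x - z.1) (y - z.2); [by rewrite distrC|by rewrite distrC|].
rewrite !subrKC (distrC (f _)) => /le_trans; apply.
rewrite (distrC x) (distrC y) -ler_pdivlMl //.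
move: x2 y2; rewrite invfM; set X := `|_|; set Y := `|_|; set E := K^-1.
by clear; lra.
Qed.

(** Adding the expansions at [z + (t, 0)], [z - (t, 0)], [z + (0, t)] and [z - (0, t)] cancels the
    odd terms and leaves [2 (A + C) t^2], which cannot be negative at a local minimum. *)
Lemma has_lap_min f z L : has_lap f z L -> (\forall w \near z, f z <= f w) ->
  0 <= L.
Proof.
move=> [a [b [A [B [C [Hf ->]]]]]] /nbhs_ballP[r /= r0 Hr].
rewrite pmulrn_lge0 // leNgt; apply/negP => AC.
(* With this precision the four errors add up to at most [- (A + C) t^2], half of the main term. *)
have [d d0 Hd] := Hf (- (A + C) / 4) ltac:(by rewrite divr_gt0 // oppr_gt0).
pose t := Num.min r d / 2.
have m0 : 0 < Num.min r d by rewrite lt_min r0.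
have t0 : 0 < t by rewrite /t divr_gt0.
have tm : t < Num.min r d by rewrite /t; clear -m0; lra.
have [tr td] : t < r /\ t < d by move: tm; rewrite lt_min => /andP[].
have nt : `|t| = t by rewrite gtr0_norm.
have key u v : `|u| <= t -> `|v| <= t -> f z <= f (z.1 + u, z.2 + v).
  move=> ut vt; apply: Hr; split; rewrite /ball /= opprD addrA subrr add0r normrN.
    exact: le_lt_trans ut tr.
  exact: le_lt_trans vt tr.
have n0 : `|0 : R| < d by rewrite normr0.
have n0t : `|0 : R| <= t by rewrite normr0 ltW.
have pt : `|t| < d by rewrite nt. have mt : `| - t| < d by rewrite normrN nt.
have ptt : `|t| <= t by rewrite nt. have mtt : `| - t| <= t by rewrite normrN nt.
move: (Hd _ _ pt n0) (Hd _ _ mt n0) (Hd _ _ n0 pt) (Hd _ _ n0 mt).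
move: (key _ _ ptt n0t) (key _ _ mtt n0t) (key _ _ n0t ptt) (key _ _ n0t mtt).
move: (f (z.1 + t, _)) (f (z.1 - t, _)) (f (_, z.2 + t)) (f (_, z.2 - t)) (f z).
move=> f1 f2 f3 f4 f0 k1 k2 k3 k4; rewrite !ler_norml.
move=> /andP[_ h1] /andP[_ h2] /andP[_ h3] /andP[_ h4].
have : 0 < - (A + C) * t ^+ 2 by rewrite mulr_gt0 ?exprn_gt0 // oppr_gt0.
clear -k1 k2 k3 k4 h1 h2 h3 h4; lra.
Qed.

(* Perturbing by [- eps |w|^2] makes the Laplacian negative, which excludes
   interior minima. *)
Lemma min_principle f (E : set (R * R)) (K : R) :
  closed E -> (forall w, E w -> `|w.1| <= K /\ `|w.2| <= K) ->
  (forall w, E w -> exists L, has_lap f w L /\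
     (0 <= f w \/ ((\forall w' \near w, E w') /\ L <= 0))) ->
  forall w, E w -> 0 <= f w.
Proof.
move=> cE EK H w0 Ew0.
have cptE : compact E.
  have cs := compact_setX (@segment_compact R (- K) K) (@segment_compact R (- K) K).
  apply: (subclosed_compact cE cs) => w /EK[].
  by rewrite !ler_norml /= !in_itv /= => -> ->.
have K0 : 0 <= K by have [+ _] := EK _ Ew0; exact: le_trans.
apply/ler_addgt0Pl => e e0.
(* On [E] one has [|w|^2 <= 2 K^2], so the perturbation [k |w|^2] is at most [e]; the [+ 1] covers
   [K = 0]. *)
pose k := e / (2 * K ^+ 2 + 1).
have K2 : 0 < 2 * K ^+ 2 + 1 by have := sqr_ge0 K; clear; lra.
have k0 : 0 < k by rewrite divr_gt0.
pose g (w : R * R) := 1 * f w + (- k) * (w.1 ^+ 2 + w.2 ^+ 2).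
have gL w L : has_lap f w L -> has_lap g w (1 * L + (- k) * 4).
  by move=> fL; apply: has_lap_lin fL (has_lap_norm2 w).
have gc : {within E, continuous g}.
  apply: continuous_in_subspaceT => w; rewrite inE => /H[L [/gL/has_lap_continuous + _]].
  by [].
have [c] := compact_EVT_min (ex_intro _ _ Ew0) cptE gc.
rewrite inE => Ec cmin.
have nE w : E w -> 0 <= w.1 ^+ 2 + w.2 ^+ 2 <= 2 * K ^+ 2.
  move=> /EK[w1 w2]; rewrite addr_ge0 ?sqr_ge0 //=.
  have h : forall x : R, `|x| <= K -> x ^+ 2 <= K ^+ 2.
    by move=> x xK; rewrite -(real_normK (num_real x)) lerXn2r ?nnegrE.
  by move: (h _ w1) (h _ w2); clear; lra.
have [L [fL [fc0|[Ecn L0]]]] := H _ Ec.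
  have := cmin w0 (mem_set Ew0); rewrite /g !mul1r.
  have /andP[c1 c2] := nE _ Ec; have /andP[w1 w2] := nE _ Ew0.
  have h1 : k * (c.1 ^+ 2 + c.2 ^+ 2) <= e.
    rewrite /k mulrAC ler_pdivrMr //; apply: ler_wpM2l; first exact: ltW.
    by apply: le_trans c2 _; clear; lra.
  have h2 : 0 <= k * (w0.1 ^+ 2 + w0.2 ^+ 2) by rewrite mulr_ge0 // ltW.
  move: h1 h2 fc0; rewrite !mulNr.
  move: (k * _) (k * _) (f c) (f w0) => x1 x2 x3 x4; clear; lra.
have : 0 <= 1 * L + (- k) * 4.
  apply: has_lap_min (gL _ _ fL) _; apply: filterS Ecn => w Ew.
  exact: cmin (mem_set Ew).
by move: k0 L0; clear; lra.
Qed.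

End HasLap.

(** * Expansions of the inverse, the logarithm, dipoles and smoothed logarithms *)

Section Functions.
Context {R : realType}.
Implicit Types (f g : R * R -> R) (z : R * R).

(** Locating the intermediate point by its absolute value alone spares the applications a case
    analysis on the sign of the increment. *)
Lemma MVT_increment (G G' : R -> R) (s : R) :
  (forall x : R, `|x| <= `|s| -> is_derive x 1 G (G' x)) ->
  exists2 c, `|c| <= `|s| & G s - G 0 = G' c * s.
Proof.
move=> dG.
have Gc x : `|x| <= `|s| -> {for x, continuous G}.
  by move=> /dG [+ _]; rewrite derivable1_diffP => /differentiable_continuous.
have [s0|s0] := leP 0 s.
  have xs x : x \in `[0, s] -> `|x| <= `|s|.
    by rewrite in_itv /= => /andP[x0 xs]; rewrite !ger0_norm.
  have [|c /xs cs e] := MVT_segment s0 (fun x xi => dG x (xs x (subset_itv_oo_cc xi))).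
    by apply: continuous_in_subspaceT => x /[!inE] /xs /Gc.
  by exists c => //; rewrite e subr0.
have xs x : x \in `[s, 0] -> `|x| <= `|s|.
  rewrite in_itv /= => /andP[x0 xs]; rewrite !ler0_norm ?lerN2 //.
  by apply: ltW.
have [|c /xs cs e] := MVT_segment (ltW s0) (fun x xi => dG x (xs x (subset_itv_oo_cc xi))).
  by apply: continuous_in_subspaceT => x /[!inE] /xs /Gc.
by exists c => //; rewrite -opprB e sub0r mulrN opprK.
Qed.

Lemma taylor1_inv (t : R) : 0 < t ->
  taylor1 (fun x => x^-1) t (- (t ^- 2)) (t ^- 3).
Proof.
move=> t0 e e0; have t4 : 0 < e * t ^+ 4 / 2.
  by rewrite divr_gt0 // mulr_gt0 // exprn_gt0.
exists (Num.min (t / 2) (e * t ^+ 4 / 2)) => [|s].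
  by rewrite lt_min t4 divr_gt0.
rewrite lt_min => /andP[s1 s2].
have ts : t / 2 < t + s by move: s1; rewrite ltr_norml => /andP[]; clear; lra.
have ts0 : 0 < t + s by apply: lt_trans ts; rewrite divr_gt0.
have -> : (t + s)^-1 - (t^-1 + - t ^- 2 * s + t ^- 3 * s ^+ 2) =
   - (s * s ^+ 2 / (t ^+ 3 * (t + s))).
  by field; rewrite !gt_eqF.
rewrite normrN normrM normfV [X in X^-1]gtr0_norm ?mulr_gt0 ?exprn_gt0 //.
rewrite normrM (ger0_norm (sqr_ge0 s)).
rewrite ler_pdivrMr ?mulr_gt0 ?exprn_gt0 // mulrAC.
apply: ler_wpM2r; first exact: sqr_ge0.
apply: (le_trans (ltW s2)).
have -> : e * t ^+ 4 / 2 = e * t ^+ 3 * (t / 2) by field.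
rewrite [leRHS]mulrA; apply: ler_wpM2l (ltW ts).
by rewrite ltW // mulr_gt0 // exprn_gt0.
Qed.

Lemma taylor1_ln (t : R) : 0 < t -> taylor1 (@ln R) t t^-1 (- (2 * t ^+ 2)^-1).
Proof.
move=> t0 e e0.
have t3 : 0 < e * t ^+ 3 / 2 by rewrite divr_gt0 // mulr_gt0 // exprn_gt0.
exists (Num.min (t / 2) (e * t ^+ 3 / 2)) => [|s].
  by rewrite lt_min t3 divr_gt0.
rewrite lt_min => /andP[s1 s2].
(* [G] is the logarithm minus its linear and quadratic terms; its derivative [x^2 / (t^2 (t + x))]
   is already of second order, so the mean value theorem gives a cubic error. *)
pose G x := ln (t + x) - (t^-1 * x - (2 * t ^+ 2)^-1 * x ^+ 2).
have tx x : `|x| <= `|s| -> t / 2 < t + x.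
  move=> xs; move: (le_lt_trans xs s1).
  by rewrite ltr_norml => /andP[]; clear; lra.
have tx0 x : `|x| <= `|s| -> 0 < t + x.
  by move=> /tx; apply: lt_trans; rewrite divr_gt0.
have [x xs|c cs] := @MVT_increment G (fun x => x ^+ 2 / (t ^+ 2 * (t + x))) s.
  have ? := is_derive1_ln (tx0 _ xs).
  rewrite /G; apply: is_derive_eq.
  rewrite /GRing.scale /=; field; rewrite !gt_eqF //; exact: tx0.
rewrite /G addr0 !mulr0 expr0n /= mulr0 !subr0 => GE.
have -> : ln (t + s) - (ln t + t^-1 * s + - (2 * t ^+ 2)^-1 * s ^+ 2) =
  c ^+ 2 / (t ^+ 2 * (t + c)) * s by rewrite -GE; ring.
have D0 : 0 < t ^+ 2 * (t + c) by rewrite mulr_gt0 ?exprn_gt0 ?tx0.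
rewrite normrM normrM normfV (gtr0_norm D0) (ger0_norm (sqr_ge0 c)).
have c2 : c ^+ 2 <= s ^+ 2.
  rewrite -(real_normK (num_real c)) -(real_normK (num_real s)).
  by rewrite lerXn2r ?nnegrE.
have sB : `|s| <= e * (t ^+ 2 * (t + c)).
  apply: (le_trans (ltW s2)).
  have -> : e * t ^+ 3 / 2 = e * (t ^+ 2 * (t / 2)) by field.
  apply: ler_wpM2l; first exact: ltW.
  by apply: ler_wpM2l; [exact: sqr_ge0|exact/ltW/tx].
rewrite mulrAC ler_pdivrMr //.
apply: le_trans (ler_pM (sqr_ge0 c) (normr_ge0 s) c2 sB) _.
by rewrite mulrCA mulrA.
Qed.

(* Re (gamma / (w - p)) with gamma = al + i be *)
Definition dipole (al be : R) (p w : R * R) : R :=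
  (al * (w.1 - p.1) + be * (w.2 - p.2)) *
  ((w.1 - p.1) ^+ 2 + (w.2 - p.2) ^+ 2)^-1.

Lemma sqr_dist_gt0 (p w : R * R) : w != p ->
  0 < (w.1 - p.1) ^+ 2 + (w.2 - p.2) ^+ 2.
Proof.
move=> wp; rewrite lt_neqAle addr_ge0 ?sqr_ge0 // andbT eq_sym.
rewrite paddr_eq0 ?sqr_ge0 // !sqrf_eq0 !subr_eq0; apply: contra wp.
by case: w p => [? ?] [? ?] /= /andP[/eqP -> /eqP ->].
Qed.

Lemma taylor2_sqr_dist (p : R * R) (c : R) z :
  taylor2 (fun w => (w.1 - p.1) ^+ 2 + (w.2 - p.2) ^+ 2 + c) z
    ((z.1 - p.1) *+ 2) ((z.2 - p.2) *+ 2) 1 0 1.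
Proof. by apply: taylor2_exact => u v /=; ring. Qed.

Lemma has_lap_dipole (al be : R) (p z : R * R) : z != p ->
  has_lap (dipole al be p) z 0.
Proof.
move=> /sqr_dist_gt0 D0.
have HN : taylor2 (fun w => al * (w.1 - p.1) + be * (w.2 - p.2)) z al be 0 0 0.
  by apply: taylor2_exact => u v /=; ring.
have D0' : 0 < (z.1 - p.1) ^+ 2 + (z.2 - p.2) ^+ 2 + 0 by rewrite addr0.
have := taylor2M HN (taylor2_comp (taylor2_sqr_dist p 0 z) (taylor1_inv D0')).
move=> /(@eq_taylor2 _ _ (dipole al be p)) H.
do 5 eexists; split; first by apply: H => w; rewrite /dipole /= addr0.
by rewrite /= addr0; field; rewrite gt_eqF.
Qed.

(** The constant [c] spreads the point mass at [p] into a positive density that decreases with the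
    distance to [p]; this monotonicity makes the potentials below superharmonic. *)
Lemma has_lap_ln_sqr_dist (p : R * R) (c : R) z : 0 < c ->
  has_lap (fun w => ln ((w.1 - p.1) ^+ 2 + (w.2 - p.2) ^+ 2 + c)) z
    (4 * c / ((z.1 - p.1) ^+ 2 + (z.2 - p.2) ^+ 2 + c) ^+ 2).
Proof.
move=> c0; set D := _ + c.
have D0 : 0 < D by rewrite ltr_wpDl ?addr_ge0 ?sqr_ge0.
do 5 eexists; split.
  exact: taylor2_comp (taylor2_sqr_dist p c z) (taylor1_ln D0).
rewrite /= -/D; have -> : c = D - (z.1 - p.1) ^+ 2 - (z.2 - p.2) ^+ 2 by rewrite /D; ring.
by field; rewrite gt_eqF.
Qed.

End Functions.

(** * Functions of class C^2 have Peano expansions *)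

Section ClassC2.
Context {R : realType}.
Implicit Types (f : R * R -> R) (z : R * R).

Lemma is_derive_slice1 f (x y t : R) : derivable f (x + t, y) (e_x R) ->
  is_derive t 1 (fun s => f (x + s, y)) ('D_(e_x R) f (x + t, y)).
Proof.
have E : (fun h : R => h^-1 *: (((fun s => f (x + s, y)) \o shift t) (h *: 1) -
      f (x + t, y))) =
    (fun h => h^-1 *: ((f \o shift (x + t, y)) (h *: e_x R) - f (x + t, y))).
  apply: funext => h; congr (_ *: (f _ - _)); congr (_, _) => /=.
    by rewrite /GRing.scale /= mulr1; ring.
  by rewrite scaler0 add0r.
by move=> H; apply: DeriveDef; rewrite /derivable /derive E.
Qed.

Lemma is_derive_slice2 f (x y t : R) : derivable f (x, y + t) (e_y R) ->
  is_derive t 1 (fun s => f (x, y + s)) ('D_(e_y R) f (x, y + t)).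
Proof.
have E : (fun h : R => h^-1 *: (((fun s => f (x, y + s)) \o shift t) (h *: 1) -
      f (x, y + t))) =
    (fun h => h^-1 *: ((f \o shift (x, y + t)) (h *: e_y R) - f (x, y + t))).
  apply: funext => h; congr (_ *: (f _ - _)); congr (_, _) => /=.
    by rewrite scaler0 add0r.
  by rewrite /GRing.scale /= mulr1; ring.
by move=> H; apply: DeriveDef; rewrite /derivable /derive E.
Qed.

(* P, Q, O are the values of f at the ends of a horizontal and then a vertical
   segment, and each hypothesis equation is an instance of the mean value
   theorem along one of these segments. *)
Let c2_remainder (e u v c c3 X1 X2 X4 A B C P Q O p0 p1 p2 q0 q3 : R) :
  let T s t := p0 * s + q0 * t + A / 2 * s ^+ 2 + B * (s * t) + C / 2 * t ^+ 2 in
  `|c| <= `|u| -> `|c3| <= `|v| ->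
  P - T u v - (Q - T 0 v) = (p1 - (p0 + A * c + B * v)) * u ->
  p1 - p2 = X1 * c -> p2 - p0 = X2 * v ->
  Q - T 0 v - (O - T 0 0) = (q3 - (q0 + C * c3)) * v ->
  q3 - q0 = X4 * c3 ->
  `|X1 - A| <= e / 2 -> `|X2 - B| <= e / 2 -> `|X4 - C| <= e / 2 ->
  `|P - (O + p0 * u + q0 * v + A / 2 * u ^+ 2 + B * (u * v) + C / 2 * v ^+ 2)|
  <= e * (u ^+ 2 + v ^+ 2).
Proof.
move=> T cu cv Ec E1 E2 Ev E4 K1 K2 K4.
have -> : P - (O + p0 * u + q0 * v + A / 2 * u ^+ 2 + B * (u * v) + C / 2 * v ^+ 2) =
    (X1 - A) * c * u + (X2 - B) * v * u + (X4 - C) * c3 * v.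
  have -> : (X1 - A) * c * u + (X2 - B) * v * u + (X4 - C) * c3 * v =
      (X1 * c + X2 * v + (p0 - p0) - A * c - B * v) * u +
      (X4 * c3 + (q0 - q0) - C * c3) * v by ring.
  rewrite -E1 -E2 -E4.
  have -> : (p1 - p2 + (p2 - p0) + (p0 - p0) - A * c - B * v) * u +
      (q3 - q0 + (q0 - q0) - C * c3) * v =
      (p1 - (p0 + A * c + B * v)) * u + (q3 - (q0 + C * c3)) * v by ring.
  by rewrite -Ec -Ev /T; clear; ring.
have bnd (p q r : R) : `|p| <= e / 2 -> `|q| <= `|r| -> `|p * q| <= e / 2 * `|r|.
  by move=> pe qr; rewrite normrM ler_pM.
have b1 := ler_wpM2r (normr_ge0 u) (bnd _ _ _ K1 cu).
have b2 := ler_wpM2r (normr_ge0 u) (bnd _ _ _ K2 (lexx `|v|)).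
have b4 := ler_wpM2r (normr_ge0 v) (bnd _ _ _ K4 cv).
have e0 : 0 <= e by have := le_trans (normr_ge0 _) K1; clear; lra.
rewrite -!normrM in b1 b2 b4.
rewrite -(real_normK (num_real u)) -(real_normK (num_real v)).
have b0 := mulr_ge0 e0 (sqr_ge0 (`|u| - `|v|)).
apply: le_trans (ler_normD _ _) _.
apply: le_trans (lerD (le_trans (ler_normD _ _) (lerD b1 b2)) b4) _.
have b5 := mulr_ge0 e0 (sqr_ge0 `|u|); have b6 := mulr_ge0 e0 (sqr_ge0 `|v|).
by move: b0 b5 b6; clear; move: `|u| `|v| => p q; lra.
Qed.

(** The mean value theorem is applied to [f] minus a quadratic polynomial on a vertical and a
    horizontal segment from [z] to the shifted point, and then to the first derivatives; continuity
    of the second derivatives bounds what remains. *)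
Lemma class_C2_has_lap (U : set (R * R)) f z :
  open U -> class_C2 U f -> U z -> has_lap f z (laplacian f z).
Proof.
case: z => x y oU fC2 Uz.
have ex : e_x R \in [:: e_x R; e_y R] by rewrite !inE eqxx.
have ey : e_y R \in [:: e_x R; e_y R] by rewrite !inE eqxx orbT.
pose fx := 'D_(e_x R) f; pose fy := 'D_(e_y R) f.
pose A := 'D_(e_x R) fx (x, y); pose B := 'D_(e_y R) fx (x, y).
pose C := 'D_(e_y R) fy (x, y).
exists (fx (x, y)), (fy (x, y)), (A / 2), B, (C / 2); split; last first.
  by rewrite /laplacian -/fx -/fy -/A -/C; field.
move=> e e0; have e2 : 0 < e / 2 by rewrite divr_gt0.
have near_z (g : R * R -> R) : {for (x, y), continuous g} ->
    exists2 d, 0 < d & forall u v, `|u| < d -> `|v| < d ->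
      `|g (x + u, y + v) - g (x, y)| <= e / 2.
  move=> /cvgrPdist_le /(_ _ e2) /nbhs_ballP[d /= d0 Hd]; exists d => // u v ud vd.
  rewrite distrC; apply: Hd.
  by split; rewrite /ball /= opprD addrA subrr add0r normrN.
have [d1 d10 H1] := near_z _ (let: And3 _ _ c := fC2 _ _ ex ex _ Uz in c).
have [d2 d20 H2] := near_z _ (let: And3 _ _ c := fC2 _ _ ex ey _ Uz in c).
have [d3 d30 H3] := near_z _ (let: And3 _ _ c := fC2 _ _ ey ey _ Uz in c).
have /nbhs_ballP[d4 /= d40 H4] := open_nbhs_nbhs (conj oU Uz).
exists (Num.min (Num.min d1 d2) (Num.min d3 d4)) => [|u v].
  by rewrite !lt_min d10 d20 d30 d40.
rewrite !lt_min => /andP[/andP[u1 u2] /andP[u3 u4]].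
move=> /andP[/andP[v1 v2] /andP[v3 v4]] /=.
have U4 s t : `|s| < d4 -> `|t| < d4 -> U (x + s, y + t).
  move=> sd td; apply: H4.
  by split; rewrite /ball /= opprD addrA subrr add0r normrN.
have n0 d : 0 < d -> `|0 : R| < d by rewrite normr0.
(* The candidate polynomial without its constant term; [B] is the mixed derivative in the order in
   which the path of segments produces it. *)
pose T s t := fx (x, y) * s + fy (x, y) * t + A / 2 * s ^+ 2 + B * (s * t) +
  C / 2 * t ^+ 2.
have [t tu|c cu Ec] := @MVT_increment R (fun s => f (x + s, y + v) - T s v)
    (fun s => fx (x + s, y + v) - (fx (x, y) + A * s + B * v)) u.
  have [df _ _] := fC2 _ _ ex ex _ (U4 _ _ (le_lt_trans tu u4) v4).
  have ? := is_derive_slice1 df.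
  rewrite /T; apply: is_derive_eq; rewrite /GRing.scale /fx /=; by field.
have [t tc|c1 cc1 Ec1] := @MVT_increment R (fun s => fx (x + s, y + v))
    (fun s => 'D_(e_x R) fx (x + s, y + v)) c.
  apply: is_derive_slice1.
  by have [_ + _] := fC2 _ _ ex ex _ (U4 _ _ (le_lt_trans (le_trans tc cu) u4) v4).
have [t tv|c2 cv2 Ec2] := @MVT_increment R (fun s => fx (x, y + s))
    (fun s => 'D_(e_y R) fx (x, y + s)) v.
  apply: is_derive_slice2.
  have := U4 0 t (n0 _ d40) (le_lt_trans tv v4); rewrite addr0 => Ut.
  by have [_ + _] := fC2 _ _ ex ey _ Ut.
have [t tv|c3 cv3 Ec3] := @MVT_increment R (fun s => f (x, y + s) - T 0 s)
    (fun s => fy (x, y + s) - (fy (x, y) + C * s)) v.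
  have := U4 0 t (n0 _ d40) (le_lt_trans tv v4); rewrite addr0 => Ut.
  have [df _ _] := fC2 _ _ ey ey _ Ut.
  have ? := is_derive_slice2 df.
  rewrite /T; apply: is_derive_eq; rewrite /GRing.scale /fy /=; by field.
have [t tc|c4 cc4 Ec4] := @MVT_increment R (fun s => fy (x, y + s))
    (fun s => 'D_(e_y R) fy (x, y + s)) c3.
  apply: is_derive_slice2.
  have := U4 0 t (n0 _ d40) (le_lt_trans (le_trans tc cv3) v4).
  by rewrite addr0 => Ut; have [_ + _] := fC2 _ _ ey ey _ Ut.
have K1 := H1 c1 v (le_lt_trans (le_trans cc1 cu) u1) v1.
have K2 := H2 0 c2 (n0 _ d20) (le_lt_trans cv2 v2).
have K4 := H3 0 c4 (n0 _ d30) (le_lt_trans (le_trans cc4 cv3) v3).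
rewrite ?addr0 in K1 K2 K4 Ec Ec1 Ec2 Ec3 Ec4.
exact: (c2_remainder cu cv3 Ec Ec1 Ec2 Ec3 Ec4 K1 K2 K4).
Qed.

Lemma open_upper_half_plane : open (@upper_half_plane R).
Proof.
have -> : @upper_half_plane R = snd @^-1` [set y : R | 0 < y] by [].
by apply: open_comp => [z _|]; [exact: cvg_snd|exact: open_gt].
Qed.

Lemma harmonic_on_has_lap h z : harmonic_on (@upper_half_plane R) h ->
  0 < z.2 -> has_lap h z 0.
Proof.
move=> [hC2 h0] zU; rewrite -(h0 z zU).
exact: class_C2_has_lap open_upper_half_plane hC2 zU.
Qed.

End ClassC2.

(** * The unit circle, superharmonicity by the Laplacian, and the minimum principle on the disc *)

Section Circle.
Context {R : realType}.
Implicit Types (f : R * R -> R) (z : R * R).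

Definition circ (t : R) : R * R := (cos t, sin t).

Definition norm2 (w : R * R) : R := w.1 ^+ 2 + w.2 ^+ 2.

Lemma normr_le1_sqr (x : R) : x ^+ 2 <= 1 -> `|x| <= 1.
Proof. by rewrite -(real_normK (num_real x)) expr_le1. Qed.

(** Infinitesimal superharmonicity; it is stable under nonnegative combinations and similarities and
    feeds the minimum principle directly. *)
Definition lap_le0 f z := exists2 L, has_lap f z L & L <= 0.

Lemma lap_le0_lin f g z (p q : R) : 0 <= p -> 0 <= q ->
  lap_le0 f z -> lap_le0 g z -> lap_le0 (fun w => p * f w + q * g w) z.
Proof.
move=> p0 q0 [L fL L0] [M gM M0]; exists (p * L + q * M); first exact: has_lap_lin.
by rewrite -oppr_ge0 opprD addr_ge0 // -mulrN mulr_ge0 ?oppr_ge0.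
Qed.

Lemma lap_le0_cst (k : R) z : lap_le0 (fun=> k) z.
Proof. by exists 0 => //; exact: has_lap_cst. Qed.

Lemma lap_le0_addr f z (k : R) : lap_le0 f z -> lap_le0 (fun w => f w + k) z.
Proof.
move=> /(lap_le0_lin ler01 ler01)/(_ (lap_le0_cst k z)).
by under eq_fun do rewrite !mul1r.
Qed.

Lemma lap_le0Z f z (k : R) : 0 <= k -> lap_le0 f z -> lap_le0 (fun w => k * f w) z.
Proof.
move=> k0 /(lap_le0_lin k0 ler01)/(_ (lap_le0_cst 0 z)).
by under eq_fun do rewrite mulr0 addr0.
Qed.

Lemma lap_le0_sum z (N : nat) (F : nat -> R * R -> R) :
  (forall k, (k < N)%N -> lap_le0 (F k) z) ->
  lap_le0 (fun w => \sum_(k < N) F k w) z.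
Proof.
elim: N => [|N IH] H.
  by under eq_fun do rewrite big_ord0; exact: lap_le0_cst.
under eq_fun do rewrite big_ord_recr /=.
have h1 := IH (fun k kN => H k (ltnW kN)).
have := lap_le0_lin ler01 ler01 h1 (H N (ltnSn N)).
by under eq_fun do rewrite !mul1r.
Qed.

Lemma lap_le0_simil f (p : R * R) (al be : R) z :
  lap_le0 f (p.1 + al * z.1 - be * z.2, p.2 + be * z.1 + al * z.2) ->
  lap_le0 (fun w => f (p.1 + al * w.1 - be * w.2, p.2 + be * w.1 + al * w.2)) z.
Proof.
move=> [L /has_lap_simil H L0]; eexists; first exact: H.
by rewrite -oppr_ge0 -mulrN mulr_ge0 ?addr_ge0 ?sqr_ge0 ?oppr_ge0.
Qed.

Lemma norm2_circ t : norm2 (circ t) = 1.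
Proof. by rewrite /norm2 /= cos2Dsin2. Qed.

Lemma circ_param z : norm2 z = 1 -> exists2 t, - pi <= t <= pi & z = circ t.
Proof.
case: z => x y; rewrite /norm2 /= => xy.
have x1 : -1 <= x <= 1.
  by rewrite -ler_norml normr_le1_sqr // -xy lerDl sqr_ge0.
have y2 : y ^+ 2 = 1 - x ^+ 2 by rewrite -xy addrAC subrr add0r.
have a0 := acos_ge0 x1; have a1 := acos_lepi x1.
have pi0 := pi_ge0 R.
have [y0|y0] := leP 0 y.
  exists (acos x); first by rewrite a1 andbT (le_trans _ a0) // oppr_le0.
  by rewrite /circ acosK ?in_itv // sin_acos // -y2 sqrtr_sqr ger0_norm.
exists (- acos x); first by rewrite lerN2 a1 (le_trans _ pi0) // oppr_le0.
by rewrite /circ cosN sinN acosK ?in_itv // sin_acos // -y2 sqrtr_sqr ltr0_norm ?opprK.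
Qed.

Lemma continuous_circ f : (forall z, norm2 z = 1 -> {for z, continuous f}) ->
  continuous (f \o circ).
Proof.
move=> fc t; apply: continuous_comp; last by apply: fc; exact: norm2_circ.
exact: cvg_pair (@continuous_cos R t) (@continuous_sin R t).
Qed.

Lemma circ_bounded f : (forall z, norm2 z = 1 -> {for z, continuous f}) ->
  exists2 B, 0 <= B & forall z, norm2 z = 1 -> f z <= B.
Proof.
move=> fc; have pi0 := pi_ge0 R.
have [|c _ Hc] := @EVT_max R (f \o circ) (- pi) pi _ (continuous_subspaceT (continuous_circ fc)).
  by apply: (le_trans _ pi0); rewrite oppr_le0.
exists (`|f (circ c)|) => // z /circ_param[t t1 ->].
by apply: le_trans (ler_norm _); apply: Hc; rewrite in_itv.
Qed.

(** The pairs of angles at which [f] differs by at least [e] form a compact set. If it is nonempty,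
    the squared distance has a minimum on it, positive because equal points give equal values, and
    this minimum serves as [d]; otherwise any [d] works. *)
Lemma circ_unif_continuous f (e : R) : 0 < e ->
  (forall z, norm2 z = 1 -> {for z, continuous f}) ->
  exists2 d, 0 < d & forall z w, norm2 z = 1 -> norm2 w = 1 ->
    norm2 (z - w) < d -> `|f z - f w| < e.
Proof.
move=> e0 fc; pose g := f \o circ; have gc : continuous g := continuous_circ fc.
pose G (p : R * R) := `|g p.1 - g p.2|.
have Gc : continuous G.
  move=> p; apply: cvg_norm; apply: cvgB.
    by apply: (@continuous_comp _ _ _ fst g); [exact: cvg_fst|exact: gc].
  by apply: (@continuous_comp _ _ _ snd g); [exact: cvg_snd|exact: gc].
pose D (p : R * R) := norm2 (circ p.1 - circ p.2).
have Dc : continuous D.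
  have h (k : R -> R) : continuous k -> continuous (fun p : R * R => (k p.1 - k p.2) ^+ 2).
    move=> kc p; have kB : (fun q : R * R => k q.1 - k q.2) q @[q --> p] --> k p.1 - k p.2.
      apply: cvgB.
        by apply: (@continuous_comp _ _ _ fst k); [exact: cvg_fst|exact: kc].
      by apply: (@continuous_comp _ _ _ snd k); [exact: cvg_snd|exact: kc].
    exact: (cvgM kB kB).
  by move=> p; apply: cvgD; [exact: (h _ (@continuous_cos R))|exact: (h _ (@continuous_sin R))].
pose Q := `[- pi, pi]%classic `*` `[- pi, pi]%classic : set (R * R).
pose K := Q `&` G @^-1` [set x | e <= x].
have cQ : compact Q by apply: compact_setX; exact: segment_compact.
have cK : compact K.
  have sub : K `<=` Q by move=> ? [].
  apply: (subclosed_compact _ cQ sub); apply: closedI.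
    by apply: compact_closed cQ; exact: norm_hausdorff.
  by apply: preimage_closed; [move=> ? _; exact: Gc|exact: closed_ge].
have [K0|nK] := pselect (K !=set0); last first.
  exists 1 => // z w /circ_param[s s1 ->] /circ_param[t t1 ->] _.
  rewrite ltNge; apply/negP => H; apply: nK; exists (s, t).
  by split => //; split; rewrite /= in_itv.
have [p] := compact_EVT_min K0 cK (continuous_subspaceT Dc).
rewrite inE => Kp Hp.
have Dp : 0 < D p.
  rewrite lt_neqAle addr_ge0 ?sqr_ge0 // andbT eq_sym; apply/negP.
  rewrite paddr_eq0 ?sqr_ge0 // !sqrf_eq0 !subr_eq0 => /andP[/eqP /= h1 /eqP /= h2].
  case: Kp => _; rewrite /G /g /= /circ h1 h2 subrr normr0.
  by rewrite leNgt e0.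
exists (D p) => // z w /circ_param[s s1 ->] /circ_param[t t1 ->] st.
rewrite ltNge; apply/negP => H.
have Kst : K (s, t) by split => //; split; rewrite /= in_itv.
by have := Hp _ (mem_set Kst); rewrite leNgt st.
Qed.

Lemma min_principle_disc f : (forall w, norm2 w <= 1 -> lap_le0 f w) ->
  (forall w, norm2 w = 1 -> 0 <= f w) -> forall w, norm2 w <= 1 -> 0 <= f w.
Proof.
move=> fL f0.
have nc : continuous norm2.
  by move=> z; have := has_lap_continuous (has_lap_norm2 z); exact.
apply: (@min_principle _ f [set w | norm2 w <= 1] 1).
- have -> : [set w | norm2 w <= 1] = norm2 @^-1` [set x | x <= 1] by [].
  by apply: preimage_closed; [move=> ? _; exact: nc|exact: closed_le].
- move=> [x y]; rewrite /norm2 /= => xy.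
  by split; apply: normr_le1_sqr; apply: le_trans xy; rewrite ?lerDl ?lerDr sqr_ge0.
- move=> w /= w1; have [L wL L0] := fL w w1; exists L; split => //.
  have [w1'|w1'] := eqVneq (norm2 w) 1; [by left; exact: f0|right; split => //].
  have : \forall w' \near w, norm2 w' < 1.
    by apply: (cvgr_lt (norm2 w) (nc w)); rewrite lt_neqAle w1' w1.
  by apply: filterS => w' /ltW.
Qed.

End Circle.

(** * The super-mean-value inequality from averages over rotations *)

Section CircleMean.
Context {R : realType}.
Implicit Types (f : R * R -> R) (z : R * R).

(** A Riemann sum for the mean over the circle which is at the same time an average over a finite
    group of rotations, so that it inherits superharmonicity from [f]. *)
Definition circle_avg f (N : nat) (t : R) : R :=
  N%:R^-1 * \sum_(k < N) f (circ (t + k%:R * (2 * pi / N%:R))).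

Lemma circ_angle_continuous f (e : R) : 0 < e ->
  (forall z, norm2 z = 1 -> {for z, continuous f}) ->
  exists2 d, 0 < d & forall s t, `|s - t| < d -> `|f (circ s) - f (circ t)| < e.
Proof.
move=> e0 /(circ_unif_continuous e0)[d d0 Hd].
have : cos x @[x --> (0 : R)] --> (1 : R) by rewrite -(cos0 R); exact: continuous_cos.
move=> /cvgrPdist_lt /(_ (d / 2)).
rewrite divr_gt0 // => /(_ isT) /nbhs_ballP[h /= h0 Hh]; exists h => // s t st.
apply: Hd; rewrite ?norm2_circ //.
have -> : norm2 (circ s - circ t) = (1 - cos (s - t)) * 2.
  rewrite /norm2 /= cosB.
  have := cos2Dsin2 s; have := cos2Dsin2 t; clear; lra.
rewrite -ltr_pdivlMr //; apply: le_lt_trans (ler_norm _) _; apply: Hh.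
by rewrite /ball /= sub0r normrN.
Qed.

Lemma circle_avg_shift f N t : (0 < N)%N ->
  circle_avg f N (t + 2 * pi / N%:R) = circle_avg f N t.
Proof.
case: N => // N _; rewrite /circle_avg; congr (_ * _).
rewrite big_ord_recr [RHS]big_ord_recl [LHS]addrC /=; congr (_ + _).
  have -> : t + 2 * pi / N.+1%:R + N%:R * (2 * pi / N.+1%:R) = t + pi *+ 2.
    have -> : N%:R = N.+1%:R - 1 :> R by rewrite -natr1 addrK.
    have : N.+1%:R != 0 :> R by rewrite pnatr_eq0.
    by move: (N.+1%:R) => x x0; field.
  by rewrite mul0r addr0 /circ cosD2pi sinD2pi.
apply: eq_bigr => k _; congr (f (circ _)).
by rewrite /bump /= add1n -natr1; ring.
Qed.

(** The average has period [2 pi / N < d] in the angle, so two angles can be brought within [d] of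
    each other, and then the sums compare term by term. *)
Lemma circle_avg_osc f N (e d : R) : (0 < N)%N -> 2 * pi / N%:R < d ->
  (forall s t, `|s - t| < d -> `|f (circ s) - f (circ t)| < e) ->
  forall s t, `|circle_avg f N s - circle_avg f N t| <= e.
Proof.
move=> N0 Nd Hd; set h := 2 * pi / N%:R in Nd.
have NR : 0 < N%:R :> R by rewrite ltr0n.
have h0 : 0 < h by rewrite divr_gt0 // mulr_gt0 // pi_gt0.
have close s t : `|s - t| < d -> `|circle_avg f N s - circle_avg f N t| <= e.
  move=> st; rewrite /circle_avg -mulrBr -sumrB normrM gtr0_norm ?invr_gt0 //.
  rewrite ler_pdivrMl //; apply: le_trans (ler_norm_sum _ _ _) _.
  have -> : N%:R * e = \sum_(k < N) e by rewrite sumr_const card_ord mulr_natl.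
  apply: ler_sum => k _; apply/ltW/Hd.
  by rewrite opprD addrACA subrr addr0.
have shift n s : circle_avg f N (s + n%:R * h) = circle_avg f N s.
  elim: n => [|n IH]; first by rewrite mul0r addr0.
  by rewrite -natr1 mulrDl mul1r addrA circle_avg_shift.
suff osc s t : s <= t -> `|circle_avg f N s - circle_avg f N t| <= e.
  by move=> s t; have [/osc//|/ltW/osc] := leP s t; rewrite distrC.
move=> st; rewrite -(shift (Num.truncn ((t - s) / h)) s); apply: close.
have /truncn_itv/andP[] : 0 <= (t - s) / h by rewrite divr_ge0 ?subr_ge0 // ltW.
rewrite ler_pdivlMr // ltr_pdivrMr // -natr1; move: (_%:R) => n h1 h2.
by rewrite ltr_norml; apply/andP; split; move: Nd h0 h1 h2; clear; lra.
Qed.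

(** As a function on the disc, the average of [f] over [N] rotations is superharmonic and takes the
    value [f (0, 0)] at the centre. On the circle it oscillates by at most [e], so it is there at
    least [circle_avg f N t - e], and the minimum principle carries this bound to the centre. *)
Lemma circle_avg_le f (e : R) : 0 < e ->
  (forall z, norm2 z <= 1 -> lap_le0 f z) ->
  exists N0, (0 < N0)%N /\ forall N, (N0 <= N)%N ->
    forall t, circle_avg f N t <= f (0, 0) + e.
Proof.
move=> e0 fL.
have fc z : norm2 z = 1 -> {for z, continuous f}.
  move=> z1; have [|L /has_lap_continuous//] := fL z.
  by rewrite z1.
have [d d0 Hd] := circ_angle_continuous e0 fc.
exists (Num.truncn (2 * pi / d)).+1; split => // N N0N t.
have N0 : (0 < N)%N by apply: leq_trans N0N.
have NR : 0 < N%:R :> R by rewrite ltr0n.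
have Nd : 2 * pi / N%:R < d.
  rewrite ltr_pdivrMr // [ltRHS]mulrC -ltr_pdivrMr //.
  apply: (@lt_le_trans _ _ (Num.truncn (2 * pi / d)).+1%:R).
    exact: truncnS_gt.
  by rewrite ler_nat.
have osc := circle_avg_osc N0 Nd Hd.
pose a k : R := k%:R * (2 * pi / N%:R).
pose F k w := f (0 + cos (a k) * w.1 - sin (a k) * w.2,
                 0 + sin (a k) * w.1 + cos (a k) * w.2).
pose v w := N%:R^-1 * (\sum_(k < N) F k w) + (e - circle_avg f N t).
have vL w : norm2 w <= 1 -> lap_le0 v w.
  move=> w1; apply: lap_le0_addr; apply: lap_le0Z; first by rewrite invr_ge0 ltW.
  apply: lap_le0_sum => k _.
  apply: (@lap_le0_simil _ f (0, 0) (cos (a k)) (sin (a k))); apply: fL => /=.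
  have -> : norm2 (0 + cos (a k) * w.1 - sin (a k) * w.2,
      0 + sin (a k) * w.1 + cos (a k) * w.2) =
     (cos (a k) ^+ 2 + sin (a k) ^+ 2) * norm2 w by rewrite /norm2 /=; ring.
  by rewrite cos2Dsin2 mul1r.
have v0 w : norm2 w = 1 -> 0 <= v w.
  move=> /circ_param[s _ ->].
  have -> : v (circ s) = circle_avg f N s + (e - circle_avg f N t).
    rewrite /v /circle_avg; congr (_ * _ + _); apply: eq_bigr => k _.
    by rewrite /F /circ cosD sinD /=; congr (f (_, _)); rewrite /a; ring.
  by have := osc s t; rewrite ler_norml => /andP[+ _]; clear; lra.
have := @min_principle_disc _ v vL v0 (0, 0).
rewrite /norm2 /= expr0n addr0 ler01 => /(_ isT).
rewrite /v; under eq_bigr do rewrite /F /= !mulr0 !addr0 subr0.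
rewrite sumr_const card_ord.
rewrite -[X in _ * X]mulr_natl mulKf ?gt_eqF //.
by clear; lra.
Qed.

Lemma Rintegral_le_riemann (g : R -> R) (e d h : R) : continuous g -> 0 < h -> h < d ->
  (forall s t, `|s - t| < d -> `|g s - g t| < e) -> forall n : nat,
  \int[lebesgue_measure]_(t in `[0, n%:R * h]) g t
    <= \sum_(k < n) h * (g (k%:R * h) + e).
Proof.
move=> gc h0 hd Hd.
have gi (x y : R) : lebesgue_measure.-integrable `[x, y]%classic (EFin \o g).
  apply: continuous_compact_integrable; first exact: segment_compact.
  exact: continuous_subspaceT.
elim=> [|n IH].
  by rewrite mul0r big_ord0 set_itv1 Rintegral_set1.
rewrite big_ord_recr /=; set x := n%:R * h in IH *.
have xS : n.+1%:R * h = x + h by rewrite -natr1 mulrDl mul1r.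
have x0 : 0 <= x by rewrite mulr_ge0 // ltW.
rewrite xS.
have := @Rintegral_itvB R g (BLeft 0) (BRight (x + h)) x (gi _ _).
rewrite !bnd_simp lerDl (ltW h0) => /(_ x0 isT) /eqP.
rewrite subr_eq addrC => /eqP ->; apply: lerD => //.
have gi' : lebesgue_measure.-integrable `]x, x + h]%classic (EFin \o g).
  apply: integrableS (gi x (x + h)) => //; exact: subset_itv_oc_cc.
have ci : lebesgue_measure.-integrable `]x, x + h]%classic (EFin \o (fun=> g x + e)).
  have cci : lebesgue_measure.-integrable `[x, x + h]%classic (EFin \o (fun=> g x + e)).
    apply: continuous_compact_integrable; first exact: segment_compact.
    by apply: continuous_subspaceT => ?; exact: cvg_cst.
  apply: integrableS cci => //; exact: subset_itv_oc_cc.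
have : forall t, `]x, x + h]%classic t -> g t <= g x + e.
  move=> t /=; rewrite in_itv /= => /andP[xt th].
  have /Hd : `|t - x| < d.
    by rewrite ger0_norm; move: xt th hd; clear; lra.
  by rewrite ltr_norml => /andP[_]; clear; lra.
move=> Hle; apply: le_trans (le_Rintegral _ gi' ci Hle) _ => //.
rewrite Rintegral_cst //= lebesgue_measure_itv /= lte_fin ltrDl h0 /=.
by rewrite mulrC addrAC subrr add0r.
Qed.

Lemma circle_mean_le f (a : R * R) (r : R) : 0 < r ->
  (forall z, closed_disc a r z -> lap_le0 f z) ->
  (circle_mean (EFin \o f) a r <= (f a)%:E)%E.
Proof.
move=> r0 fL; pose g t := f (a.1 + r * cos t, a.2 + r * sin t).
pose F w := f (a.1 + r * w.1 - 0 * w.2, a.2 + 0 * w.1 + r * w.2).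
have Fg : F \o circ = g.
  by apply: funext => t; rewrite /F /g /= !mul0r subr0 addr0.
have FL w : norm2 w <= 1 -> lap_le0 F w.
  move=> w1; apply: (@lap_le0_simil _ f a r 0); apply: fL.
  rewrite /closed_disc /= !mul0r subr0 addr0 -[leRHS]mulr1.
  have -> : (a.1 + r * w.1 - a.1) ^+ 2 + (a.2 + r * w.2 - a.2) ^+ 2 =
    r ^+ 2 * norm2 w by rewrite /norm2; ring.
  by apply: ler_wpM2l => //; exact: sqr_ge0.
have Fc z : norm2 z = 1 -> {for z, continuous F}.
  move=> z1; have [|L /has_lap_continuous//] := FL z.
  by rewrite z1.
have gc : continuous g by rewrite -Fg; exact: continuous_circ.
have gi : lebesgue_measure.-integrable `[0, 2 * pi]%classic (EFin \o g).
  apply: continuous_compact_integrable; first exact: segment_compact.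
  exact: continuous_subspaceT.
have pi20 : 0 < 2 * pi :> R by rewrite mulr_gt0 // pi_gt0.
have F0 : F (0, 0) = f a.
  by rewrite /F /= !mulr0 subr0 !addr0; case: (a).
rewrite /circle_mean -(fineK (integrable_fin_num _ gi)) // -EFinM lee_fin.
rewrite -/(Rintegral _ _ _) ler_pdivrMl //; apply/ler_addgt0Pl => e e0.
(* Over an interval of length [2 pi], one [e1] pays for the Riemann sum and another for
   [circle_avg_le]. *)
pose e1 := e / (2 * (2 * pi)).
have e10 : 0 < e1 by rewrite divr_gt0 // mulr_gt0.
have [N0 [N00 HN]] := circle_avg_le e10 FL.
have [d d0 Hd] := circ_angle_continuous e10 Fc.
pose N := maxn N0 (Num.truncn (2 * pi / d)).+1.
have NR : 0 < N%:R :> R by rewrite ltr0n; apply: leq_trans N00 _; rewrite leq_maxl.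
have Nd : 2 * pi / N%:R < d.
  rewrite ltr_pdivrMr // [ltRHS]mulrC -ltr_pdivrMr //.
  apply: (@lt_le_trans _ _ (Num.truncn (2 * pi / d)).+1%:R).
    exact: truncnS_gt.
  by rewrite ler_nat leq_maxr.
have Hg s t : `|s - t| < d -> `|g s - g t| < e1 by rewrite -Fg; exact: Hd.
have := Rintegral_le_riemann gc (divr_gt0 pi20 NR) Nd Hg N.
have -> : N%:R * (2 * pi / N%:R) = 2 * pi :> R by field; rewrite gt_eqF.
move=> /le_trans; apply.
rewrite -mulr_sumr big_split /= sumr_const card_ord.
have := HN N (leq_maxl _ _) 0; rewrite F0.
have -> : circle_avg F N 0 = N%:R^-1 * \sum_(k < N) g (k%:R * (2 * pi / N%:R)).
  by rewrite -Fg; congr (_ * _); apply: eq_bigr => k _; rewrite add0r.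
move: (\sum_(_ < _) _) => S; rewrite ler_pdivrMl // => HS.
rewrite mulrAC ler_pdivrMr // -[X in S + X]mulr_natl.
have Ee : e = 2 * (2 * pi) * e1 by rewrite /e1 mulrC divfK // gt_eqF // mulr_gt0.
have -> : (e + 2 * pi * f a) * N%:R = 2 * pi * (N%:R * (f a + e1) + N%:R * e1).
  by rewrite Ee; ring.
by rewrite ler_pM2l // lerD2r.
Qed.

End CircleMean.

(** * The Poisson kernel, Harnack's inequality and a comparison function in the half-plane *)

Section Harnack.
Context {R : realType}.
Implicit Types (f : R * R -> R) (z w : R * R).

(* The Poisson kernel (rho^2 - |z|^2) / |z - zeta|^2, zeta = rho e^(it) *)
Definition poisson (rho t : R) (z : R * R) : R :=
  dipole (- 2 * rho * cos t) (- 2 * rho * sin t) (rho * cos t, rho * sin t) z - 1.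

Definition pole_dist2 (rho t : R) (z : R * R) : R :=
  (z.1 - rho * cos t) ^+ 2 + (z.2 - rho * sin t) ^+ 2.

(** Both sides are the real part of [(zeta + z) / (zeta - z) = - 2 zeta / (z - zeta) - 1]. The
    dipole form shows harmonicity, the quotient shows sign and size. *)
Lemma poissonE rho t z : pole_dist2 rho t z != 0 ->
  poisson rho t z = (rho ^+ 2 - norm2 z) / pole_dist2 rho t z.
Proof.
rewrite /poisson /dipole /pole_dist2 /norm2 /= => D0.
have -> : rho ^+ 2 = rho ^+ 2 * (cos t ^+ 2 + sin t ^+ 2) by rewrite cos2Dsin2 mulr1.
by field.
Qed.

Lemma pole_dist2_gt0 rho t z : 1 < rho -> norm2 z <= 1 -> 0 < pole_dist2 rho t z.
Proof.
move=> r1 z1; rewrite /pole_dist2.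
apply: (@sqr_dist_gt0 _ (rho * cos t, rho * sin t)); apply/eqP => zE.
move: z1; rewrite zE /norm2 /= !exprMn -mulrDr cos2Dsin2 mulr1 leNgt.
have r0 : 0 <= rho by apply: le_trans (ltW r1).
by rewrite expr_gt1 // r1.
Qed.

Lemma has_lap_poisson rho t z : 1 < rho -> norm2 z <= 1 ->
  has_lap (poisson rho t) z 0.
Proof.
move=> r1 z1; have /has_lap_dipole H : z != (rho * cos t, rho * sin t).
  apply/eqP => zE; have := pole_dist2_gt0 t r1 z1.
  by rewrite /pole_dist2 zE /= !subrr expr0n addr0 ltxx.
have := has_lap_lin 1 1 (H (- 2 * rho * cos t) (- 2 * rho * sin t))
  (has_lap_cst (- 1) z).
by rewrite !mulr0 addr0; under eq_fun do rewrite !mul1r.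
Qed.

(** For points of the circle away from [circ t] the distance to the pole stays bounded below as
    [rho] tends to 1, which localizes the kernel. *)
Lemma pole_dist2_circle rho t z : norm2 z = 1 ->
  pole_dist2 rho t z = (rho - 1) ^+ 2 + rho * norm2 (z - circ t).
Proof.
move=> z1; apply/eqP; rewrite -subr_eq0; apply/eqP.
rewrite [LHS](_ : _ = (1 - rho) * (norm2 z - 1) +
    (rho ^+ 2 - rho) * (norm2 (circ t) - 1)).
  by rewrite z1 norm2_circ !subrr !mulr0 addr0.
by rewrite /pole_dist2 /norm2 /=; ring.
Qed.

(** On the circle the kernel depends only on the cosine of the difference of angles, so moving the
    pole amounts to moving the point. *)
Lemma circle_avg_poisson rho t (N : nat) : 1 < rho ->
  N%:R^-1 * \sum_(k < N) poisson rho (k%:R * (2 * pi / N%:R)) (circ t) =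
  circle_avg (poisson rho 0) N (- t).
Proof.
move=> r1; congr (_ * _); apply: eq_bigr => k _; set a := k%:R * _.
have c1 s : norm2 (circ s) <= 1 :> R by rewrite norm2_circ.
rewrite !poissonE ?gt_eqF ?pole_dist2_gt0 // !norm2_circ.
congr (_ / _); rewrite !pole_dist2_circle ?norm2_circ //; congr (_ + _ * _).
have E u v : norm2 (circ u - circ v) = 2 - 2 * cos (u - v) :> R.
  rewrite /norm2 /= cosB; have := cos2Dsin2 u; have := cos2Dsin2 v.
  by clear; lra.
by rewrite !E subr0 -[cos (- t + a)]cosN opprD opprK.
Qed.

(** If [circ t] is near [z], then [f (circ t) <= f z + e]; if it is far, the kernel is at most
    [(rho^2 - 1) / d]. *)
Lemma poisson_le_circle f (e d B rho t : R) z : 0 <= e -> 0 < d -> 0 <= B ->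
  1 < rho -> norm2 z = 1 ->
  (forall w, norm2 w = 1 -> 0 <= f w <= B) ->
  (forall w, norm2 w = 1 -> norm2 (z - w) < d -> `|f z - f w| < e) ->
  f (circ t) * poisson rho t z <=
    (f z + e) * poisson rho t z + B * (rho ^+ 2 - 1) / d.
Proof.
move=> e0 d0 B0 r1 z1 fB fd.
have r0 : 0 < rho by exact: lt_trans r1.
have r21 : 0 <= rho ^+ 2 - 1 by rewrite subr_ge0 ltW // expr_gt1 // ltW.
have z1' : norm2 z <= 1 by rewrite z1.
have D0 := pole_dist2_gt0 t r1 z1'.
have P0 : 0 <= poisson rho t z.
  by rewrite poissonE ?gt_eqF // z1 divr_ge0 // ltW.
have /andP[fz0 _] := fB _ z1; have /andP[ft0 ftB] := fB _ (norm2_circ t).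
have [zt|zt] := ltP (norm2 (z - circ t)) d.
  have h : f (circ t) <= f z + e.
    have := fd _ (norm2_circ t) zt; rewrite ltr_norml => /andP[+ _].
    by clear; lra.
  apply: le_trans (ler_wpM2r P0 h) _; rewrite lerDl.
  by rewrite divr_ge0 ?mulr_ge0 // ltW.
apply: (@le_trans _ _ (B * (rho ^+ 2 - 1) / d)); last first.
  by rewrite lerDr mulr_ge0 // addr_ge0.
apply: le_trans (ler_wpM2r P0 ftB) _; rewrite poissonE ?gt_eqF // z1 mulrA.
apply: ler_wpM2l; first exact: mulr_ge0.
rewrite lef_pV2 ?posrE // pole_dist2_circle //.
apply: (le_trans zt); apply: (@le_trans _ _ (rho * norm2 (z - circ t))).
  by rewrite ler_peMl ?(ltW r1) // addr_ge0 ?sqr_ge0.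
by rewrite lerDr sqr_ge0.
Qed.

(** The numerator is at least [1 - 1/4], and the denominator at most
    [2 |z|^2 + 2 rho^2 <= 1/2 + 9/2 = 5]. *)
Lemma poisson_ge rho t z : 1 < rho -> rho <= 3 / 2 -> norm2 z <= 4^-1 ->
  3 / 20 <= poisson rho t z.
Proof.
move=> r1 r2 z1; have z1' : norm2 z <= 1 by move: z1; clear; lra.
have D0 := pole_dist2_gt0 t r1 z1'.
rewrite poissonE ?gt_eqF // ler_pdivlMr //.
have D5 : pole_dist2 rho t z <= 5.
  have : pole_dist2 rho t z <= 2 * norm2 z + 2 * rho ^+ 2 * (cos t ^+ 2 + sin t ^+ 2).
    rewrite -subr_ge0 [leRHS](_ : _ = (z.1 + rho * cos t) ^+ 2 + (z.2 + rho * sin t) ^+ 2).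
      by rewrite addr_ge0 ?sqr_ge0.
    by rewrite /pole_dist2 /norm2; ring.
  have : rho ^+ 2 <= (3 / 2) ^+ 2 by rewrite lerXn2r ?nnegrE //; move: r1; clear; lra.
  by rewrite cos2Dsin2; move: z1; move: (norm2 z); clear => x; lra.
have : 1 <= rho ^+ 2 by rewrite expr_ge1 ?(ltW r1) //; move: r1; clear; lra.
by move: D5 z1; move: (norm2 z) (pole_dist2 _ _ _); clear => x y; lra.
Qed.

Lemma lap0_lap_le0 f z (k : R) : has_lap f z 0 -> lap_le0 (fun w => k * f w) z.
Proof.
move=> fL; exists 0 => //.
have := has_lap_lin k 0 fL (has_lap_cst 0 z).
by rewrite !mulr0 addr0; under eq_fun do rewrite addr0.
Qed.

Lemma lap_le0D f g z : lap_le0 f z -> lap_le0 g z -> lap_le0 (fun w => f w + g w) z.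
Proof.
move=> fL /(lap_le0_lin ler01 ler01 fL).
by under eq_fun do rewrite !mul1r.
Qed.

(** On the circle the Riemann sum of the Poisson integral of [f], with poles of modulus [rho > 1],
    exceeds [f] by at most a small [K], hence also inside. There the kernel is at least [3 / 20],
    and the average of [f] on the circle is nearly [f (0, 0)] or more. *)
Lemma harnack_disc f w : (forall z, norm2 z <= 1 -> has_lap f z 0) ->
  (forall z, norm2 z <= 1 -> 0 <= f z) -> norm2 w <= 4^-1 ->
  3 / 20 * f (0, 0) <= f w.
Proof.
move=> fL f0 w4.
have fc z : norm2 z = 1 -> {for z, continuous f}.
  by move=> z1; apply: has_lap_continuous (fL z _); rewrite z1.
have [B B0 fB] := circ_bounded fc.
have fB' z : norm2 z = 1 -> 0 <= f z <= B by move=> z1; rewrite fB // f0 // z1.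
apply/ler_addgt0Pl => e' e0'.
pose e := Num.min 1 (e' / (B + 4)).
have B4 : 0 < B + 4 by move: B0; clear; lra.
have e0 : 0 < e by rewrite /e lt_min ltr01 divr_gt0.
have e1 : e <= 1 by rewrite /e ge_min lexx.
have eB : e * (B + 4) <= e' by rewrite -ler_pdivlMr // /e ge_min lexx orbT.
have [d d0 Hd] := circ_unif_continuous e0 fc.
(* Since [rho^2 - 1 = h (2 + h) <= 3 h], this choice makes the far contribution [B (rho^2 - 1) / d]
   at most [e]. *)
pose h := Num.min (1 / 2) (e * d / (3 * (B + 1))).
have B1 : 0 < 3 * (B + 1) by move: B0; clear; lra.
have h0 : 0 < h by rewrite lt_min !divr_gt0 // mulr_gt0.
have h2 : h <= 1 / 2 by rewrite /h ge_min lexx.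
have hB : h * (3 * (B + 1)) <= e * d by rewrite -ler_pdivlMr // /h ge_min lexx orbT.
pose rho := 1 + h.
have r1 : 1 < rho by rewrite ltrDl.
have r2 : rho <= 3 / 2 by move: h2; rewrite /rho; clear; lra.
have rB : B * (rho ^+ 2 - 1) / d <= e.
  rewrite ler_pdivrMr //; apply: le_trans hB.
  have -> : rho ^+ 2 - 1 = h * (2 + h) by rewrite /rho; ring.
  rewrite mulrCA; apply: ler_wpM2l; first exact: ltW.
  have : B * (2 + h) <= B * 3 by apply: ler_wpM2l => //; move: h2; clear; lra.
  by clear; lra.
have NL z : norm2 z <= 1 -> lap_le0 (fun z => -1 * f z) z.
  by move=> z1; apply: lap0_lap_le0; exact: fL.
(* Applied to [- f], the mean value inequality bounds the average of [f] from below. *)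
have [N1 [N10 HN1]] := circle_avg_le e0 NL.
have PL z : norm2 z <= 1 -> lap_le0 (fun z => 1 * poisson rho 0 z) z.
  by move=> z1; apply: lap0_lap_le0; exact: has_lap_poisson.
have [N2 [N20 HN2]] := circle_avg_le e0 PL.
pose N := maxn N1 N2.
have NR : 0 < N%:R :> R by rewrite ltr0n; apply: leq_trans N10 _; rewrite leq_maxl.
pose a k : R := k%:R * (2 * pi / N%:R).
(* The kernel equals 1 at the centre, so its average over the poles is at most [1 + e] on the
   circle. *)
have P1 z : norm2 z = 1 -> N%:R^-1 * \sum_(k < N) poisson rho (a k) z <= 1 + e.
  move=> /circ_param[t _ ->]; rewrite circle_avg_poisson //.
  have := HN2 N (leq_maxr _ _) (- t); rewrite /circle_avg.
  under eq_bigr do rewrite mul1r.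
  rewrite mul1r poissonE /norm2 /pole_dist2 /= cos0 sin0 !mulr0 mulr1 !sub0r.
    by rewrite oppr0 expr0n /= !addr0 subr0 sqrrN divff // expf_eq0 gt_eqF // (lt_trans ltr01).
  by rewrite oppr0 expr0n addr0 sqrrN expf_eq0 gt_eqF // (lt_trans ltr01).
have favg : f (0, 0) - e <= N%:R^-1 * \sum_(k < N) f (circ (a k)).
  have := HN1 N (leq_maxl _ _) 0; rewrite /circle_avg.
  have -> : \sum_(k < N) -1 * f (circ (0 + k%:R * (2 * pi / N%:R))) =
      - \sum_(k < N) f (circ (a k)).
    by rewrite -sumrN; apply: eq_bigr => k _; rewrite mulN1r add0r.
  by rewrite mulrN; clear; lra.
(* [(f z + e) (1 + e) + e <= f z + e (B + 3)], by [f z <= B] and [e <= 1]. *)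
pose K := e * (B + 3).
pose v z := (f z + \sum_(k < N) (- (N%:R^-1 * f (circ (a k)))) * poisson rho (a k) z) + K.
have uE z : \sum_(k < N) (- (N%:R^-1 * f (circ (a k)))) * poisson rho (a k) z =
    - (N%:R^-1 * \sum_(k < N) f (circ (a k)) * poisson rho (a k) z).
  by rewrite mulr_sumr -sumrN; apply: eq_bigr => k _; rewrite mulNr mulrA.
have vL z : norm2 z <= 1 -> lap_le0 v z.
  move=> z1; apply: lap_le0_addr; apply: lap_le0D.
    by exists 0 => //; exact: fL.
  apply: (lap_le0_sum (F := fun k z => - (N%:R^-1 * f (circ (a k))) * poisson rho (a k) z)).
  by move=> k _; apply: lap0_lap_le0; exact: has_lap_poisson.
have v0 z : norm2 z = 1 -> 0 <= v z.
  move=> z1; rewrite /v uE; have /andP[fz0 fzB] := fB' _ z1.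
  have H1 : N%:R^-1 * \sum_(k < N) f (circ (a k)) * poisson rho (a k) z <=
      (f z + e) * (N%:R^-1 * \sum_(k < N) poisson rho (a k) z) + e.
    rewrite ler_pdivrMl // mulrDr [X in _ <= X + _](_ : _ =
        (f z + e) * \sum_(k < N) poisson rho (a k) z); last first.
      by rewrite mulrCA mulVKf ?gt_eqF.
    rewrite mulr_sumr mulr_natl -[X in e *+ X](card_ord N) -sumr_const -big_split /=.
    apply: ler_sum => k _; apply: le_trans (poisson_le_circle _ (ltW e0) d0 B0 r1 z1 fB' _) _.
      by move=> w' w1' zw; apply: Hd.
    by rewrite lerD2l.
  have fze : 0 <= f z + e by rewrite addr_ge0 // ltW.
  have := ler_wpM2l fze (P1 z z1); move: H1.
  have : e * f z <= e * B by rewrite ler_pM2l.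
  have : e * e <= e * 1 by rewrite ler_pM2l.
  rewrite /K; move: (N%:R^-1 * _) (N%:R^-1 * _) => x y; clear; lra.
have w1 : norm2 w <= 1 by move: w4; clear; lra.
have := min_principle_disc vL v0 w1; rewrite /v uE.
have : 3 / 20 * (f (0, 0) - e) <=
    N%:R^-1 * \sum_(k < N) f (circ (a k)) * poisson rho (a k) w.
  apply: (@le_trans _ _ (3 / 20 * (N%:R^-1 * \sum_(k < N) f (circ (a k))))).
    by apply: ler_wpM2l favg; clear; lra.
  rewrite mulrCA; apply: ler_wpM2l; first by rewrite invr_ge0 ltW.
  rewrite mulr_sumr; apply: ler_sum => k _; rewrite mulrC.
  by apply: ler_wpM2l; [rewrite f0 // norm2_circ|exact: poisson_ge].
rewrite /K; move: (N%:R^-1 * _) eB e0 => x; clear; lra.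
Qed.

(* The harmonic comparison function is [(y + 1) / (x^2 + (y + 1)^2) - 2 / 5],
   positive exactly inside the circle [x^2 + (y + 1)^2 = 5 / 2 (y + 1)], which
   contains (0, 1) and meets the upper half-plane within [|x| <= 2]. *)
Lemma barrier h (a m : R) : (forall z, 0 < z.2 -> has_lap h z 0) ->
  (forall z, 0 < z.2 -> 0 <= h z) -> 0 < a -> a < 1 -> 0 <= m ->
  (forall x, `|x| <= 2 -> m <= h (x, a)) -> m / 10 <= h (0, 1).
Proof.
move=> hL h0 a0 a1 m0 hm.
pose P := dipole 0 1 (0, -1 : R).
have PE z : P z = (z.2 + 1) / (z.1 ^+ 2 + (z.2 + 1) ^+ 2).
  by rewrite /P /dipole /= mul0r add0r mul1r subr0 opprK.
pose q (z : R * R) := z.1 ^+ 2 + (z.2 + 1) ^+ 2 - 5 / 2 * (z.2 + 1).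
have qc : continuous q.
  move=> z; apply: (@has_lap_continuous _ q z ((1 + 1) *+ 2)).
  exists (z.1 *+ 2), ((z.2 + 1) *+ 2 - 5 / 2), 1, 0, 1; split => //.
  by apply: taylor2_exact => u v; rewrite /q /=; ring.
pose E := [set z : R * R | a <= z.2] `&` [set z | q z <= 0].
(* [v = h - m (P - 2/5)]. It is nonnegative on the line [y = a], where [h >= m] and [P <= 1], and on
   the arc [q = 0], where [P = 2/5]; since [P (0, 1) = 1/2], its value at (0, 1) is
   [h (0, 1) - m / 10]. *)
pose v z := 1 * (1 * h z + (- m) * P z) + 1 * (m * (2 / 5)).
have vL z : 0 < z.2 -> has_lap v z 0.
  move=> z0; have PL : has_lap P z 0.
    apply: has_lap_dipole; apply/eqP => zE; move: z0.
    by rewrite zE /= ltr0N1.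
  have := has_lap_lin 1 1 (has_lap_lin 1 (- m) (hL z z0) PL) (has_lap_cst (m * (2 / 5)) z).
  by rewrite !mulr0 !addr0 mulr0.
have E2 z : E z -> `|z.1| <= 2 /\ `|z.2| <= 2.
  case: z => x y [/= ay]; rewrite /q /= !ler_norml => qz.
  (* [q z <= 0] describes the disc of radius 5/4 about (0, 1/4). *)
  have x0 := sqr_ge0 x; have y0 := sqr_ge0 (y - 1 / 4).
  have x2 : x ^+ 2 <= 2 ^+ 2 by move: qz y0; clear; lra.
  have y2 : (y - 1 / 4) ^+ 2 <= (5 / 4) ^+ 2 by move: qz x0; clear; lra.
  move: x2 y2; rewrite -[x ^+ 2]real_normK ?num_real // -[(y - _) ^+ 2]real_normK ?num_real //.
  rewrite !ler_sqr ?nnegrE ?divr_ge0 //= !ler_norml => x2 y2; split => //.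
  by move: y2; clear; lra.
have P1 : P (0, 1) = 1 / 2.
  by rewrite PE /= expr0n add0r expr2 invfM mulrA divff //; lra.
suff : 0 <= v (0, 1) by rewrite /v P1; clear; lra.
apply: (@min_principle _ v E 2 _ E2).
- apply: closedI.
    have -> : [set z : R * R | a <= z.2] = snd @^-1` [set x | a <= x] by [].
    by apply: preimage_closed; [move=> ? _; exact: cvg_snd|exact: closed_ge].
  have -> : [set z | q z <= 0] = q @^-1` [set x | x <= 0] by [].
  by apply: preimage_closed; [move=> ? _; exact: qc|exact: closed_le].
- move=> z Ez; have [z1 _] := E2 z Ez; case: Ez => /= az qz.
  have z0 : 0 < z.2 := lt_le_trans a0 az.
  have D0 : 0 < z.1 ^+ 2 + (z.2 + 1) ^+ 2.
    by rewrite ltr_wpDl ?sqr_ge0 // exprn_gt0 // addr_gt0.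
  exists 0; split; first exact: vL.
  have [za|za] := eqVneq z.2 a.
    left; have hz : m <= h z by rewrite (surjective_pairing z) za; exact: hm.
    have : m * P z <= m * 1.
      apply: ler_wpM2l => //; rewrite PE ler_pdivrMr // mul1r.
      by have := sqr_ge0 z.1; move: z0; clear; nra.
    by rewrite /v; move: hz m0; clear; lra.
  have [q0|q0] := eqVneq (q z) 0.
    left; rewrite /v PE; have -> : z.1 ^+ 2 + (z.2 + 1) ^+ 2 = 5 / 2 * (z.2 + 1).
      by apply/eqP; rewrite -subr_eq0 -/(q z) q0.
    have -> : (z.2 + 1) / (5 / 2 * (z.2 + 1)) = 2 / 5.
      by field; rewrite gt_eqF // addr_gt0.
    by have := h0 _ z0; clear; lra.
  right; split => //.
  have n1 : \forall w \near z, a < w.2.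
    by apply: (cvgr_gt z.2 (@cvg_snd _ _ _ _ _)); rewrite lt_neqAle eq_sym za.
  have n2 : \forall w \near z, q w < 0.
    by apply: (cvgr_lt (q z) (qc z)); rewrite lt_neqAle q0.
  by apply: filterS2 n1 n2 => w /ltW ? /ltW.
by split; rewrite /q /=; [exact: ltW|clear; lra].
Qed.

End Harnack.

(** * Smoothed Green potentials and rows of poles *)

Section Potentials.
Context {R : realType}.

(** Up to a constant factor, the Green function of the half-plane with pole [p], made finite at [p]
    by [c]. *)
Definition potential (eps c : R) (p z : R * R) : R :=
  eps * (ln ((z.1 - p.1) ^+ 2 + (z.2 + p.2) ^+ 2 + c) -
         ln ((z.1 - p.1) ^+ 2 + (z.2 - p.2) ^+ 2 + c)).

Section SinglePole.
Variables (eps c : R) (p z : R * R).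
Hypotheses (eps0 : 0 < eps) (c0 : 0 < c) (p0 : 0 < p.2) (z0 : 0 < z.2).

Let D := (z.1 - p.1) ^+ 2 + (z.2 - p.2) ^+ 2.
Let D' := (z.1 - p.1) ^+ 2 + (z.2 + p.2) ^+ 2.

Let D0 : 0 <= D. Proof. by rewrite addr_ge0 ?sqr_ge0. Qed.

Let D'E : D' = D + 4 * (p.2 * z.2). Proof. by rewrite /D /D'; ring. Qed.

Let DD' : D + c < D' + c.
Proof. by rewrite ltrD2r D'E ltrDl !mulr_gt0. Qed.

Let Dc : 0 < D + c. Proof. exact: ltr_wpDl. Qed.

Let D'c : 0 < D' + c. Proof. exact: lt_trans DD'. Qed.

(** The point [z] is closer to [p] than to its mirror image, so the subtracted logarithm has the
    larger Laplacian. *)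
Lemma potential_lap_le0 : lap_le0 (potential eps c p) z.
Proof.
have H := has_lap_lin eps (- eps) (has_lap_ln_sqr_dist (p.1, - p.2) z c0)
  (has_lap_ln_sqr_dist p z c0).
rewrite /= opprK -/D' -/D in H.
have E : (fun w : R * R => eps * ln ((w.1 - p.1) ^+ 2 + (w.2 + p.2) ^+ 2 + c) +
   - eps * ln ((w.1 - p.1) ^+ 2 + (w.2 - p.2) ^+ 2 + c)) = potential eps c p.
  by apply: funext => w; rewrite /potential mulrBr mulNr.
rewrite E in H; eexists; first exact: H.
rewrite mulNr -mulrBr pmulr_rle0 // subr_le0.
apply: ler_wpM2l; first by rewrite mulr_ge0 // ltW.
by rewrite lef_pV2 ?posrE ?exprn_gt0 //; apply: lerXn2r; rewrite ?nnegrE; exact: ltW.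
Qed.

Lemma potential_gt0 : 0 < potential eps c p z.
Proof. by rewrite mulr_gt0 // subr_gt0 ltr_ln ?posrE. Qed.

(** By [4 p.2 z.2 <= 2 (z.2 - p.2)^2 + 6 p.2^2], the squared distance to the mirror image is at most
    [3 D + 6 p.2^2]. *)
Lemma potential_le (t : R) : 0 < t -> t <= D + c ->
  potential eps c p z <= eps * ln (3 + 6 * p.2 ^+ 2 / t).
Proof.
move=> t0 tD; apply: ler_wpM2l; first exact: ltW.
rewrite -/D' -/D -ln_div ?posrE //.
have R0 : 0 < (D' + c) / (D + c) by rewrite divr_gt0.
have R1 : (D' + c) / (D + c) <= 3 + 6 * p.2 ^+ 2 / t.
  apply: (@le_trans _ _ (3 + 6 * p.2 ^+ 2 / (D + c))).
    rewrite ler_pdivrMr // mulrDl divfK ?gt_eqF // D'E /D.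
    have := sqr_ge0 (z.1 - p.1); have := sqr_ge0 (z.2 - p.2 - p.2).
    by move: c0; lra.
  rewrite lerD2l; apply: ler_wpM2l; first by rewrite mulr_ge0 ?sqr_ge0.
  by rewrite lef_pV2 ?posrE.
by rewrite ler_ln ?posrE // (lt_le_trans R0).
Qed.

End SinglePole.

Definition row_point (a : R) (k : nat) : R * R := (-2 + k%:R * (a / 4), a).

Lemma row_point_inj (a x : R) (j k : nat) : 0 < a ->
  `|x - (row_point a j).1| < a / 8 -> `|x - (row_point a k).1| < a / 8 -> j = k.
Proof.
move=> a0; rewrite !ltr_norml /= => /andP[j1 j2] /andP[k1 k2].
apply/eqP; rewrite eqn_leq -[(j <= k)%N]ltnS -[(k <= j)%N]ltnS -!(ltr_nat R) -!natr1.
by apply/andP; split; rewrite -(ltr_pM2r a0); move: j1 j2 k1 k2; clear; lra.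
Qed.

Lemma small_factor (x1 x2 x3 y1 y2 y3 : R) :
  0 < x1 -> 0 < x2 -> 0 < x3 -> 0 < y1 -> 0 < y2 -> 0 < y3 ->
  exists2 eps, 0 < eps &
    [/\ eps * ln x1 <= y1, eps * ln x2 <= y2 & eps * ln x3 <= y3].
Proof.
move=> x10 x20 x30 y10 y20 y30.
pose eps := Num.min (y1 / x1) (Num.min (y2 / x2) (y3 / x3)).
have eps0 : 0 < eps by rewrite !lt_min !divr_gt0.
have epsln (x y : R) : 0 < x -> eps <= y / x -> eps * ln x <= y.
  move=> x0; rewrite ler_pdivlMr //; apply: le_trans.
  by apply: ler_wpM2l; [exact: ltW|exact/ltW/ln_sublinear].
by exists eps => //; split; apply: epsln => //; rewrite !ge_min lexx ?orbT.
Qed.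

(** First [eps] is taken so small that each potential is negligible at distance [a / 8] from its
    pole, whatever [c] is; then [c] is tuned to make the peaks of height between [M / 2] and [M].
    Poles being [a / 4] apart, at most one peak is felt at any point. *)
Lemma row_superharmonic (a M eta : R) : 0 < a -> a <= 1 -> 0 < M -> 0 < eta ->
  exists psi : R * R -> R,
  [/\ forall z, 0 < z.2 -> lap_le0 psi z /\ 0 < psi z,
      forall z, 0 < z.2 -> a / 4 <= `|z.2 - a| -> psi z <= eta,
      forall z, 0 < z.2 -> psi z <= eta + M
    & forall x, `|x| <= 2 -> exists2 x', `|x - x'| <= a / 4 & M / 2 <= psi (x', a)].
Proof.
move=> a0 a1 M0 eta0.
(* [K.+1] steps of length [a / 4] cover more than the length 4 of the segment. *)
have [K Ka] : exists K : nat, 16 / a < K.+1%:R.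
  by exists (Num.truncn (16 / a)); exact: truncnS_gt.
have K0 : 0 < K.+1%:R :> R by rewrite ltr0n.
have a20 : 0 < 4 * a ^+ 2 by rewrite mulr_gt0 ?exprn_gt0.
(* [387 = 3 + 6 * 64] bounds the quotient at distance [a / 8]; the second bound yields [c <= 1], and
   the third the height [M / 2] at a pole. *)
have [eps eps0 [e1 e2 e3]] : exists2 eps, 0 < eps & [/\ eps * ln 387 <= eta / K.+1%:R,
    eps * ln 9 <= M & eps * ln (9 / (4 * a ^+ 2)) <= M / 2].
  by apply: small_factor; rewrite ?divr_gt0 ?ltr0n.
(* [c] solves [eps ln (9 / c) = M], and [3 + 6 a^2 / c <= 9 / c] bounds the quotient at a peak. *)
have [c c0 epslnc] : exists2 c : R, 0 < c & eps * ln c = eps * ln 9 - M.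
  exists (9 * expR (- (M / eps))); first by rewrite mulr_gt0 ?expR_gt0.
  rewrite lnM ?posrE ?expR_gt0 // expRK mulrBr; congr (_ - _).
  by rewrite mulrCA divff ?gt_eqF ?mulr1.
have c1 : c <= 1.
  by rewrite -ler_ln ?posrE // ln1 -(pmulr_rle0 _ eps0) epslnc subr_le0.
pose pot k := potential eps c (row_point a k).
have far k z : 0 < z.2 -> a ^+ 2 / 64 <=
    (z.1 - (row_point a k).1) ^+ 2 + (z.2 - a) ^+ 2 -> pot k z <= eta / K.+1%:R.
  move=> z0 zk; apply: le_trans e1.
  have -> : 387 = 3 + 6 * a ^+ 2 / (a ^+ 2 / 64) by field; rewrite gt_eqF.
  apply: potential_le => //; first by rewrite divr_gt0 // exprn_gt0.
  by apply: le_trans zk _; rewrite lerDl ltW.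
have peak k z : 0 < z.2 -> pot k z <= M.
  move=> z0; apply: (@le_trans _ _ (eps * ln (9 / c))); last first.
    by rewrite ln_div ?posrE // mulrBr epslnc opprB addrC subrK.
  apply: le_trans (potential_le eps0 c0 _ z0 c0 _) _ => //.
    by rewrite lerDr addr_ge0 ?sqr_ge0.
  apply: ler_wpM2l; first exact: ltW.
  rewrite ler_ln ?posrE ?addr_gt0 ?divr_gt0 ?mulr_gt0 ?exprn_gt0 //.
  rewrite ler_pdivlMr // mulrDl divfK ?gt_eqF //=.
  have : a ^+ 2 <= 1 by rewrite expr_le1 // ltW.
  by move: c1; clear; lra.
have pot0 k z : 0 < z.2 -> 0 < pot k z by move=> z0; apply: potential_gt0.
have etaE : eta = \sum_(k < K.+1) eta / K.+1%:R.
  by rewrite sumr_const card_ord -[RHS]mulr_natr divfK ?gt_eqF.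
exists (fun z => \sum_(k < K.+1) pot k z); split.
- move=> z z0; split.
    by apply: lap_le0_sum => k _; apply: potential_lap_le0.
  rewrite big_ord_recl ltr_pwDl ?pot0 // sumr_ge0 // => k _; exact/ltW/pot0.
- move=> z z0 za; rewrite [leRHS]etaE; apply: ler_sum => k _; apply: far => //.
  apply: (@le_trans _ _ ((z.2 - a) ^+ 2)); last by rewrite lerDr sqr_ge0.
  rewrite -(real_normK (num_real (z.2 - a))).
  apply: (@le_trans _ _ ((a / 4) ^+ 2)); first by move: (sqr_ge0 a); clear; lra.
  by rewrite lerXn2r ?nnegrE // divr_ge0 // ltW.
- move=> z z0.
  pose near k := (z.1 - (row_point a k).1) ^+ 2 + (z.2 - a) ^+ 2 < a ^+ 2 / 64.
  have [[k0 nk0]|nn] := pselect (exists k0 : 'I_K.+1, near k0); last first.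
    apply: (@le_trans _ _ eta); last by rewrite lerDl ltW.
    rewrite [leRHS]etaE; apply: ler_sum => k _; apply: far => //.
    by rewrite leNgt; apply/negP => nk; apply: nn; exists k.
  have near8 k : near k -> `|z.1 - (row_point a k).1| < a / 8.
    rewrite /near => nk.
    have a8 : 0 <= a / 8 by rewrite divr_ge0 // ltW.
    rewrite -ltr_sqr ?nnegrE // real_normK ?num_real //.
    have := sqr_ge0 (z.2 - a); move: nk; move: (z.1 - _) (z.2 - _) => x y.
    by clear; lra.
  (* The pole [k0] accounts for [M]; every other pole is far and contributes at most
     [eta / K.+1]. *)
  rewrite etaE (bigD1 k0) //= addrC; apply: lerD; last exact: peak.
  rewrite [leRHS](bigD1 k0) //=; apply: ler_wpDl; first by rewrite ltW ?divr_gt0.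
  apply: ler_sum => k kk0; apply: far => //; rewrite leNgt; apply/negP => nk.
  by case/eqP: kk0; apply/val_inj/(row_point_inj a0 (near8 _ nk) (near8 _ nk0)).
- move=> x; rewrite ler_norml => /andP[x1 x2].
  have x0 : 0 <= (x + 2) / (a / 4) by rewrite !divr_ge0 ?(ltW a0) //; move: x1; clear; lra.
  have /andP[k1 k2] := truncn_itv x0; set k := Num.truncn _ in k1 k2.
  have a4 : 0 < a / 4 by rewrite divr_gt0.
  have kK : (k < K.+1)%N.
    rewrite -(ltr_nat R); apply: (le_lt_trans k1); apply: le_lt_trans Ka.
    rewrite invf_div mulrA.
    by rewrite ler_wpM2r ?invr_ge0 ?(ltW a0) //; move: x2; clear; lra.
  move: k1 k2; rewrite ler_pdivlMr // ltr_pdivrMr // -[k.+1%:R]natr1 => k1 k2.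
  exists (row_point a k).1.
    rewrite /= ger0_norm; move: k1 k2; clear; lra.
  rewrite (bigD1 (Ordinal kK)) //=; apply: ler_wpDr.
    by apply: sumr_ge0 => j _; exact/ltW/pot0.
  rewrite /pot /potential /= !subrr expr0n !add0r.
  rewrite mulrBr epslnc.
  have : eps * ln (4 * a ^+ 2) <= eps * ln ((a + a) ^+ 2 + c).
    apply: ler_wpM2l; first exact: ltW.
    have -> : (a + a) ^+ 2 = 4 * a ^+ 2 by ring.
    by rewrite ler_ln ?posrE ?addr_gt0 // lerDl ltW.
  by move: e3; rewrite ln_div ?posrE // mulrBr; clear; lra.
Qed.

End Potentials.

(** * Superharmonicity of a convergent series *)

Section Series.
Context {R : realType}.

(** Near a point, a continuous partial sum already exceeding [a] gives lower semicontinuity;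
    termwise integration of the nonnegative series gives the mean value inequality. *)
Lemma superharmonic_series (psi : nat -> R * R -> R) (phi : R * R -> R) :
  (forall n z, 0 < z.2 -> lap_le0 (psi n) z /\ 0 < psi n z) ->
  (forall z, 0 < z.2 -> (phi z)%:E = (\sum_(n <oo) (psi n z)%:E)%E) ->
  superharmonic (@upper_half_plane R) (fun z => (phi z)%:E).
Proof.
move=> psiP phiE.
have psi0 n z : 0 < z.2 -> (0 <= (psi n z)%:E)%E.
  by move=> z0; rewrite lee_fin ltW //; have [] := psiP n z z0.
have psic n z : 0 < z.2 -> {for z, continuous (psi n)}.
  by move=> z0; have [[L /has_lap_continuous]] := psiP n z z0.
split => //.
- by exists (0, 1) => //=; rewrite /upper_half_plane /=.
- move=> z zU a; rewrite phiE // => az.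
  have [N aN] : exists N, a < \sum_(k < N) psi k z.
    apply: contrapT => nN.
    suff : (\sum_(n <oo) (psi n z)%:E <= a%:E)%E by rewrite leNgt az.
    apply: lime_le; first by apply: is_cvg_nneseries => n _ _; exact: psi0.
    apply: nearW => N; rewrite big_mkord sumEFin lee_fin leNgt.
    by apply/negP => H; apply: nN; exists N.
  have Sc : {for z, continuous (fun w => \sum_(k < N) psi k w)}.
    have [L /has_lap_continuous//] : lap_le0 (fun w => \sum_(k < N) psi k w) z.
    by apply: lap_le0_sum => k _; have [] := psiP k z zU.
  have n1 : \forall w \near z, a < \sum_(k < N) psi k w := cvgr_gt _ Sc _ aN.
  have n2 : \forall w \near z, @upper_half_plane R w.
    exact: open_nbhs_nbhs (conj (@open_upper_half_plane R) zU).
  near=> w; have aw : a < \sum_(k < N) psi k w by near: w; exact: n1.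
  have wU : upper_half_plane w by near: w; exact: n2.
  rewrite phiE //.
  apply: (@lt_le_trans _ _ (\sum_(0 <= k < N) (psi k w)%:E)%E).
    by rewrite big_mkord sumEFin lte_fin.
  by apply: nneseries_lim_ge => k _ _; exact: psi0.
- move=> a r r0 aU; have a0 : 0 < a.2.
    by apply: aU; rewrite /closed_disc /= !subrr expr0n addr0 sqr_ge0.
  have cU t : 0 < a.2 + r * sin t.
    apply: (aU (a.1 + r * cos t, a.2 + r * sin t)).
    rewrite /closed_disc /= [leLHS](_ : _ = r ^+ 2 * (cos t ^+ 2 + sin t ^+ 2)); last by ring.
    by rewrite cos2Dsin2 mulr1.
  pose g n t := psi n (a.1 + r * cos t, a.2 + r * sin t).
  have gc n : continuous (g n).
    move=> t; apply: (@continuous_comp _ _ _ (fun t => (a.1 + r * cos t, a.2 + r * sin t))).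
      have lin (p q : R) (k : R -> R) : continuous k ->
          p + q * k u @[u --> t] --> p + q * k t.
        by move=> kc; apply: cvgD; [exact: cvg_cst|apply: cvgM; [exact: cvg_cst|exact: kc]].
      exact: cvg_pair (lin a.1 r _ (@continuous_cos R)) (lin a.2 r _ (@continuous_sin R)).
    by apply: psic; exact: cU.
  have pi2 : 0 < 2 * pi :> R by rewrite mulr_gt0 // pi_gt0.
  rewrite /circle_mean.
  under eq_integral => t _ do [rewrite phiE; last exact: cU].
  rewrite integral_nneseries //=; last 2 first.
  + move=> n; apply/measurable_EFinP; apply: measurable_funTS.
    exact: (continuous_measurable_fun (gc n)).
  + by move=> n t _; apply: psi0; exact: cU.
  rewrite -nneseriesZl; last first.
    by move=> n _; apply: integral_ge0 => t _; apply: psi0; exact: cU.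
  rewrite phiE //; apply: lee_nneseries.
    move=> n _ _; rewrite mule_ge0 ?lee_fin ?invr_ge0 ?(ltW pi2) //.
    by apply: integral_ge0 => t _; apply: psi0; exact: cU.
  move=> n _; apply: (@circle_mean_le _ (psi n) a r r0) => z /aU zU.
  by have [] := psiP n z zU.
Unshelve. all: by end_near. Qed.

End Series.

(** * From the poles of a row to the point (0, 1) *)

Section Majorant.
Context {R : realType}.

(** The disc of radius [a / 2] about [(x', a)] stays in the half-plane and [x] lies within half its
    radius. Harnack's inequality there costs a factor [3 / 20], and the comparison function a
    further [1 / 10]. *)
Lemma majorant_row_le (h : R * R -> R) (a m : R) :
  harmonic_on (@upper_half_plane R) h -> (forall z, 0 < z.2 -> 0 <= h z) ->
  0 < a -> a < 1 -> 0 <= m ->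
  (forall x, `|x| <= 2 -> exists2 x', `|x - x'| <= a / 4 & m <= h (x', a)) ->
  3 / 200 * m <= h (0, 1).
Proof.
move=> hh h0 a0 a1 m0 hm.
have hL z : 0 < z.2 -> has_lap h z 0 by exact: harmonic_on_has_lap.
have -> : 3 / 200 * m = 3 / 20 * m / 10 by field.
apply: (barrier hL h0 a0 a1); first by move: m0; clear; lra.
move=> x /hm[x' xx' mx'].
have a2 : 0 < a / 2 by rewrite divr_gt0.
pose F w := h (x' + a / 2 * w.1 - 0 * w.2, a + 0 * w.1 + a / 2 * w.2).
have w0 (w : R * R) : norm2 w <= 1 -> 0 < a + 0 * w.1 + a / 2 * w.2.
  move=> w1; have : `|w.2| <= 1.
    by apply: normr_le1_sqr; apply: le_trans w1; rewrite lerDr sqr_ge0.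
  rewrite ler_norml mul0r addr0 => /andP[w2 _].
  have : a / 2 * (- 1) <= a / 2 * w.2 by rewrite ler_pM2l.
  by move: a0; clear; lra.
have FL w : norm2 w <= 1 -> has_lap F w 0.
  move=> w1; have := hL (x' + a / 2 * w.1 - 0 * w.2, a + 0 * w.1 + a / 2 * w.2) (w0 w w1).
  by move=> /(@has_lap_simil _ h (x', a)); rewrite mulr0.
have F0 w : norm2 w <= 1 -> 0 <= F w by move=> /w0 w1; exact: h0.
have w4 : norm2 (2 * (x - x') / a, 0 : R) <= 4^-1.
  have -> : norm2 (2 * (x - x') / a, 0 : R) = 4 * `|x - x'| ^+ 2 / a ^+ 2.
    rewrite /norm2 /= expr0n addr0 real_normK ?num_real //.
    by field; rewrite gt_eqF.
  rewrite ler_pdivrMr ?exprn_gt0 //.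
  have : `|x - x'| ^+ 2 <= (a / 4) ^+ 2.
    by apply: lerXn2r xx'; rewrite nnegrE // ltW // divr_gt0.
  by clear; lra.
have := harnack_disc FL F0 w4.
have -> : F (0, 0) = h (x', a) by rewrite /F /= !mulr0 !addr0 subr0.
have -> : F (2 * (x - x') / a, 0) = h (x, a).
  rewrite /F /= !mulr0 mul0r !addr0 subr0; congr (h (_, _)).
  by field; rewrite gt_eqF.
by apply: le_trans; apply: ler_wpM2l mx'; clear; lra.
Qed.

End Majorant.

(** * Construction of [phi] and absence of a harmonic majorant *)

Theorem proposition5 (R : realType) (s : R -> R)
    (s_gt0 : forall t, 0 < t -> 0 < s t)
    (s_decr : forall t u, 0 < t -> t <= u -> s u <= s t)
    (s_lim : s t @[t --> 0^'+] --> +oo) :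
  exists (phi : R * R -> R) (y0 : R),
    [/\ superharmonic (@upper_half_plane R) (fun z => (phi z)%:E),
        forall z, upper_half_plane z -> 0 < phi z,
        0 < y0,
        forall x y, 0 < y -> y < y0 -> phi (x, y) <= s y
      & ~ exists h : R * R -> R,
            harmonic_on (@upper_half_plane R) h /\
            forall z, upper_half_plane z -> phi z <= h z].
Proof.
have s_big A : exists2 d, 0 < d & forall t, 0 < t -> t < d -> A < s t.
  have /cvgryPgt /(_ A) [d /= d0 Hd] := s_lim; exists d => // t t0 td.
  by apply: Hd => //=; rewrite sub0r normrN gtr0_norm.
(* Where [s >= 2] one has [1 + s / 2 <= s], which leaves room for the total error 1 beside [M n]. *)
have [d d0 Hd] := s_big 2.
pose t0 := Num.min 1 (d / 2).
have t00 : 0 < t0 by rewrite lt_min ltr01 divr_gt0.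
have t01 : t0 <= 1 by rewrite ge_min lexx.
have t0d : t0 < d.
  by apply: (@le_lt_trans _ _ (d / 2)); [rewrite ge_min lexx orbT|move: d0; clear; lra].
have s2 t : 0 < t -> t <= t0 -> 2 <= s t.
  by move=> tp tt; apply/ltW/Hd => //; exact: le_lt_trans t0d.
(* Starting with the exponent 1 makes the errors sum to at most 1 and gives [2 a n <= t0]. *)
pose eta (n : nat) : R := 2^-1 ^+ n.+1.
have eta0 n : 0 < eta n by rewrite exprn_gt0 // invr_gt0.
pose a n := t0 * eta n.
have a0 n : 0 < a n by rewrite mulr_gt0.
have eta1 n : eta n <= 2^-1.
  by rewrite /eta exprS ler_piMr // exprn_ile1 // invf_le1 // ler1n.
have a2 n : 2 * a n <= t0.
  have := ler_wpM2l (ltW t00) (eta1 n); rewrite -/(a n); clear; lra.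
have a1 n : a n < 1 by move: (a2 n) (a0 n) t01; clear; lra.
(* The band around [a n] lies below height [2 a n], so [s (2 a n)] bounds [s] from below on it. *)
pose M n := s (2 * a n) / 2.
have M0 n : 0 < M n by rewrite divr_gt0 // s_gt0 // mulr_gt0.
have [psi psiP] := choice (fun n => row_superharmonic (a0 n) (ltW (a1 n)) (M0 n) (eta0 n)).
have psi1 n z : 0 < z.2 -> lap_le0 (psi n) z /\ 0 < psi n z by have [+ _ _ _] := psiP n; exact.
have eta_sum N : \sum_(k < N) eta k <= 1.
  suff -> : \sum_(k < N) eta k = 1 - 2^-1 ^+ N by rewrite lerBlDr lerDl exprn_ge0 // invr_ge0.
  elim: N => [|N IH]; first by rewrite big_ord0 expr0 subrr.
  by rewrite big_ord_recr /= IH /eta exprS; move: (2^-1 ^+ N) => x; field.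
(* For [i < j] one has [a i >= 2 a j], so the lower edge [3/4 a i] lies above the upper edge
   [5/4 a j]. *)
have bands m n y : `|y - a m| < a m / 4 -> `|y - a n| < a n / 4 -> m = n.
  have lt i j : (i < j)%N -> `|y - a i| < a i / 4 -> `|y - a j| < a j / 4 -> False.
    move=> ij; rewrite !ltr_norml => /andP[i1 i2] /andP[j1 j2].
    have : a j * 2 <= a i.
      rewrite /a -mulrA ler_pM2l // /eta (exprS _ j) mulrC mulVKf ?pnatr_eq0 //.
      by rewrite ler_wiXn2l // ?invr_ge0 // invf_le1 // ler1n.
    by move: (a0 j) i1 i2 j1 j2; clear; lra.
  by move=> ym yn; have [/lt/(_ ym yn)|/lt/(_ yn ym)|] := ltngtP m n.
(* At most one band contains [z.2]; its term adds at most [M n] to the errors, whose sum is at most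
   1. *)
have bound z : 0 < z.2 -> exists2 B, (forall N, \sum_(k < N) psi k z <= B) &
    (z.2 < t0 -> B <= s z.2).
  move=> z0; have [[n zn]|nn] := pselect (exists n, `|z.2 - a n| < a n / 4).
    exists (1 + M n) => [N|zt].
      apply: (@le_trans _ _ (\sum_(k < N) (eta k + if k == n :> nat then M n else 0))).
        apply: ler_sum => k _; have [_ p2 p3 _] := psiP k.
        have [<-|kn] := eqVneq (k : nat) n; first exact: p3.
        rewrite addr0; apply: p2 => //; rewrite leNgt; apply/negP => zk.
        by case/eqP: kn; exact: bands zk zn.
      rewrite big_split /=; apply: lerD; first exact: eta_sum.
      have [nN|Nn] := ltnP n N.
        rewrite (bigD1 (Ordinal nN)) //= eqxx big1 ?addr0 // => k kn.
        by rewrite ifN.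
      rewrite big1 ?ltW // => k _; rewrite ifN // neq_ltn.
      by rewrite (leq_trans (ltn_ord k) Nn).
    apply: (@le_trans _ _ (s (2 * a n))).
      rewrite /M; have := s2 (2 * a n) _ (a2 n).
      rewrite mulr_gt0 // => /(_ isT); clear; lra.
    by apply: s_decr => //; move: zn (a0 n); rewrite ltr_norml => /andP[_]; clear; lra.
  exists 1 => [N|zt].
    apply: le_trans (eta_sum N); apply: ler_sum => k _; have [_ p2 _ _] := psiP k.
    by apply: p2 => //; rewrite leNgt; apply/negP => zk; apply: nn; exists k.
  by apply: le_trans (s2 _ z0 (ltW zt)); rewrite ler1n.
(* [fine] would send an infinite sum to 0; [bound] excludes this in the half-plane. *)
pose phi (z : R * R) := fine (\sum_(n <oo) (psi n z)%:E)%E.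
have psi0 z : 0 < z.2 -> forall n : nat, (0 <= (psi n z)%:E)%E.
  by move=> z0 n; rewrite lee_fin ltW //; have [] := psi1 n z z0.
have series_le z B : 0 < z.2 -> (forall N, \sum_(k < N) psi k z <= B) ->
    (\sum_(n <oo) (psi n z)%:E <= B%:E)%E.
  move=> z0 HB; apply: lime_le; first by apply: is_cvg_nneseries => n _ _; exact: psi0.
  by apply: nearW => N; rewrite big_mkord sumEFin lee_fin.
have phiE z : 0 < z.2 -> (phi z)%:E = (\sum_(n <oo) (psi n z)%:E)%E.
  move=> z0; rewrite /phi fineK // ge0_fin_numE.
    have [B HB _] := bound z z0.
    by apply: le_lt_trans (series_le z B z0 HB) _; rewrite ltry.
  by apply: nneseries_ge0 => n _ _; exact: psi0.
have phi_ge n z : 0 < z.2 -> psi n z <= phi z.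
  move=> z0; rewrite -lee_fin phiE //.
  apply: (@le_trans _ _ (\sum_(0 <= k < n.+1) (psi k z)%:E)%E).
    rewrite big_mkord sumEFin lee_fin big_ord_recr /= lerDr sumr_ge0 // => k _.
    by rewrite ltW //; have [] := psi1 k z z0.
  by apply: nneseries_lim_ge => k _ _; exact: psi0.
have phi0 z : 0 < z.2 -> 0 < phi z.
  by move=> z0; apply: lt_le_trans (phi_ge 0%N z z0); have [] := psi1 0%N z z0.
exists phi, t0; split => //.
- exact: superharmonic_series psi1 phiE.
- move=> x y y0 yt; have [B HB /(_ yt) Bs] := bound (x, y) y0.
  by apply: le_trans Bs; rewrite -lee_fin phiE //; exact: series_le.
- move=> [h [hh hphi]].
  have h0 z : 0 < z.2 -> 0 <= h z.
    by move=> z0; apply: le_trans (hphi z z0); exact/ltW/phi0.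
  (* At the poles of row [n], [h >= phi >= psi n >= M n / 2]. *)
  have Mh n : 3 / 200 * (M n / 2) <= h (0, 1).
    apply: (majorant_row_le hh h0 (a0 n) (a1 n)); first by rewrite divr_ge0 // ltW.
    move=> x /(let: And4 _ _ _ p := psiP n in p x)[x' xx' Mx'].
    exists x' => //; apply: le_trans Mx' _.
    by apply: le_trans (phi_ge n (x', a n) (a0 n)) _; exact: (hphi (x', a n) (a0 n)).
  (* As [M n / 2 = s (2 a n) / 4], the bound [Mh] says [s (2 a n) <= 4 (200 / 3) h (0, 1)], which
     fails once [2 a n < d1]. *)
  have [d1 d10 Hd1] := s_big (4 * (200 / 3) * h (0, 1)).
  have [n nd] : exists n, 2 * a n < d1.
    have : (fun n => 2^-1 ^+ n : R) @ \oo --> (0 : R).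
      by apply: cvg_expr; rewrite ger0_norm ?invr_ge0 // invf_lt1 // ltr1n.
    move=> /cvgrPdist_lt /(_ _ d10) [n _ /(_ n (leqnn n))].
    rewrite sub0r normrN ger0_norm ?exprn_ge0 ?invr_ge0 // => nd; exists n.
    apply: le_lt_trans nd; rewrite /a /eta exprS.
    have : 0 <= 2^-1 ^+ n :> R by rewrite exprn_ge0 // invr_ge0.
    move: (2^-1 ^+ n) => x x0.
    have -> : 2 * (t0 * (2^-1 * x)) = t0 * x by field.
    by rewrite ler_piMl.
  have a20 : 0 < 2 * a n by rewrite mulr_gt0.
  have := Hd1 _ a20 nd; have := Mh n; rewrite /M; move: (s _) (h _) => x y.
  by clear; lra.
Qed.
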